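(* Let $R$ be a semiperfect noetherian basic ring and let $e \in R$ be an idempotent such that $R/\langle 1-e\rangle$ is right artinian. Suppose further that all idempotent subrings $\Gamma$ sandwiched between $\Gamma_e$ and $R$ have finite global dimension. Then there is a decomposition $S_e = S_1 \oplus \dots \oplus S_n$ into simple summands such that $\operatorname{Ext}_R^k(S_i,S_j) = 0$ for all $1 \le j \le i \le n$ and all $k > 0$.
   Context: Conventions: rings are associative and unital; ''noetherian'' means left and right noetherian; all modules are right modules. For an idempotent $e \in R$: $\langle 1-e\rangle$ is the two-sided ideal of $R$ generated by $1-e$; $\Gamma_e := (1-e)R(1-e)$ is the idempotent subring with identity $1-e$; $S_e := eR/\operatorname{rad} eR$ is the semisimple right $R$-module belonging to $e$. For an idempotent $e' \in R$, the idempotent subring $\Gamma_{e'} = (1-e')R(1-e')$ is called sandwiched between $\Gamma_e$ and $R$ if $\Gamma_e \subseteq \Gamma_{e'} \subseteq R$ (equivalently $e'e = ee' = e'$). In particular $R$ itself (the case $e'=0$) and $\Gamma_e$ are sandwiched. *)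

(* Defs.v *)
From HB Require Import structures.
From mathcomp Require Import all_boot all_order all_algebra.
From mathcomp Require Import boolp.

Set Implicit Arguments.
Unset Strict Implicit.
Unset Printing Implicit Defensive.

Import GRing.Theory.
Local Open Scope ring_scope.
Local Open Scope quotient_scope.

(* Rings are [pzRingType]s: the zero ring has to be allowed, because the
   corner ring (1 - e)R(1 - e) and the quotient R / <1 - e> may vanish.
   A right R-module is a left module over the converse ring R^c: for
   [a : R^c] and [v : M], [a *: v] is the product of v by a on the right. *)
Notation rmodType R := (lmodType R^c).
Notation right_regular R := ((R^c)^o).

Section Modules.
Variable A : pzRingType.

Section SubAndQuotient.
Variables (M : lmodType A) (N : submodClosed M).

Lemma submod_zmod_closed : zmod_closed (N : {pred M}).
Proof.
split=> [|x y Nx Ny]; first exact: rpred0.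
by rewrite rpredD // -scaleN1r rpredZ.
Qed.

Lemma submod_submod_closed : submod_closed (N : {pred M}).
Proof.
split=> [|a x y Nx Ny]; first exact: rpred0.
by rewrite rpredD // rpredZ.
Qed.

Definition submod_pred : M -> bool := fun x => x \in N.
HB.instance Definition _ :=
  GRing.isZmodClosed.Build M submod_pred submod_zmod_closed.
HB.instance Definition _ :=
  GRing.isScaleClosed.Build A M submod_pred (fun a => @rpredZ A M N a).

Record submod := Submod {
  submod_val :> M;
  submod_valP : submod_val \in submod_pred
}.
HB.instance Definition _ := [isSub for submod_val].
HB.instance Definition _ := [Choice of submod by <:].
HB.instance Definition _ :=
  GRing.SubChoice_isSubZmodule.Build M submod_pred submod submod_zmod_closed.
HB.instance Definition _ :=
  GRing.SubZmodule_isSubLmodule.Build A M submod_pred submod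
    submod_submod_closed.

Definition quotmod := Quotient.quot (GRing.ZmodClosed.clone M submod_pred _).
HB.instance Definition _ := Quotient.on quotmod.
HB.instance Definition _ := GRing.Zmodule.on quotmod.

Definition quotmod_scale (a : A) (x : quotmod) : quotmod :=
  \pi_quotmod (a *: repr x).

Lemma quotmod_eqE (x y : M) :
  (\pi_quotmod x == \pi_quotmod y) = (x - y \in N).
Proof. by rewrite -Quotient.idealrBE. Qed.

Lemma quotmod_piD (x y : M) :
  \pi_quotmod (x + y) = \pi_quotmod x + \pi_quotmod y.
Proof. exact: Quotient.pi_add. Qed.

Lemma quotmod_piZ (a : A) (x : M) :
  \pi_quotmod (a *: x) = quotmod_scale a (\pi_quotmod x).
Proof.
apply/eqP; rewrite quotmod_eqE -scalerBr rpredZ //.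
by rewrite -quotmod_eqE reprK.
Qed.

Lemma quotmod_scaleA a b x :
  quotmod_scale a (quotmod_scale b x) = quotmod_scale (a * b) x.
Proof.
by elim/quotW: x => x; rewrite -(quotmod_piZ b x) -!quotmod_piZ scalerA.
Qed.

Lemma quotmod_scale1 : left_id 1 quotmod_scale.
Proof. by elim/quotW=> x; rewrite -quotmod_piZ scale1r. Qed.

Lemma quotmod_scaleDr : right_distributive quotmod_scale +%R.
Proof.
move=> a; elim/quotW=> x; elim/quotW=> y.
by rewrite -quotmod_piD -!quotmod_piZ scalerDr quotmod_piD.
Qed.

Lemma quotmod_scaleDl x : {morph quotmod_scale^~ x : a b / a + b}.
Proof.
by elim/quotW: x => x a b; rewrite -!quotmod_piZ scalerDl quotmod_piD.
Qed.

HB.instance Definition _ := GRing.Zmodule_isLmodule.Build A quotmod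
  quotmod_scaleA quotmod_scale1 quotmod_scaleDr quotmod_scaleDl.

End SubAndQuotient.

Implicit Type M : lmodType A.

Definition iso_mod (M N : lmodType A) :=
  exists f : {linear M -> N}, bijective f.

Definition simple_mod M :=
  (exists x : M, x != 0) /\
  forall N : submodClosed M, N =i pred1 0 \/ N =i predT.

Definition semisimple_mod M :=
  forall N : submodClosed M, exists K : submodClosed M,
    (forall x, x \in N -> x \in K -> x = 0) /\
    (forall x, exists y z, [/\ y \in N, z \in K & x = y + z]).

Definition noetherian_mod M :=
  forall N : nat -> submodClosed M,
    (forall i, {subset N i <= N i.+1}) ->
    exists m, forall i, (m <= i)%N -> N i =i N m.

Definition artinian_mod M :=
  forall N : nat -> submodClosed M,
    (forall i, {subset N i.+1 <= N i}) ->
    exists m, forall i, (m <= i)%N -> N i =i N m.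

Definition maximal_submod M (N : submodClosed M) :=
  ~ (N =i predT) /\
  forall K : submodClosed M, {subset N <= K} -> K =i N \/ K =i predT.

Definition rad_pred M : M -> bool :=
  fun x => `[< forall N : submodClosed M, maximal_submod N -> x \in N >].
Arguments rad_pred : clear implicits.

Lemma rad_predP M (x : M) :
  reflect (forall N : submodClosed M, maximal_submod N -> x \in N)
          (x \in rad_pred M).
Proof. exact: asboolP. Qed.

Lemma rad_submod_closed M : submod_closed (rad_pred M).
Proof.
split=> [|a x y /rad_predP Jx /rad_predP Jy]; apply/rad_predP => N maxN.
  exact: rpred0.
by rewrite rpredD // ?rpredZ ?Jx ?Jy.
Qed.

HB.instance Definition _ M :=
  GRing.isSubmodClosed.Build A M (rad_pred M) (rad_submod_closed M).

Definition rad M : submodClosed M :=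
  GRing.SubmodClosed.clone A M (rad_pred M) _.
Arguments rad : clear implicits.

Lemma radP M (x : M) :
  reflect (forall N : submodClosed M, maximal_submod N -> x \in N)
          (x \in rad M).
Proof. exact: rad_predP. Qed.

Definition projective_mod (P : lmodType A) :=
  forall (M N : lmodType A) (f : {linear M -> N}) (g : {linear P -> N}),
    (forall y, exists x, f x = y) ->
    exists h : {linear P -> M}, forall x, f (h x) = g x.

Record proj_resolution M := ProjResolution {
  res_obj :> nat -> lmodType A;
  res_diff : forall i, {linear res_obj i.+1 -> res_obj i};
  res_aug : {linear res_obj 0%N -> M};
  res_proj : forall i, projective_mod (res_obj i);
  res_aug_surj : forall y, exists x, res_aug x = y;
  res_exact0 : forall x, res_aug x = 0 <-> exists y, res_diff 0%N y = x;
  res_exactS : forall i x,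
    res_diff i x = 0 <-> exists y, res_diff i.+1 y = x
}.

Definition projdim_le M (d : nat) :=
  exists P : proj_resolution M, forall i, (d < i)%N -> forall x : P i, x = 0.

(* Cocycles and coboundaries of degree k in the complex Hom_A(P, N). *)
Definition cocycle M (P : proj_resolution M) (N : lmodType A) (k : nat)
    (f : {linear P k -> N}) : Prop :=
  forall x, f (res_diff P k x) = 0.

Definition coboundary M (P : proj_resolution M) (N : lmodType A) (k : nat) :
    {linear P k -> N} -> Prop :=
  match k with
  | 0%N => fun f => forall x, f x = 0
  | k'.+1 => fun f =>
      exists g : {linear P k' -> N}, forall x, f x = g (res_diff P k' x)
  end.

(* Ext^k(M, N) = H^k(Hom_A(P, N)), which does not depend on P up to
   isomorphism; its vanishing says that all cocycles are coboundaries. *)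
Definition Ext_eq0 (k : nat) (M N : lmodType A) :=
  forall (P : proj_resolution M) (f : {linear P k -> N}),
    cocycle f -> coboundary f.

End Modules.

Arguments rad_pred {A} M _.
Arguments rad {A} M.

Section Rings.
Implicit Type R : pzRingType.

Definition right_noetherian R := noetherian_mod (right_regular R).
Definition left_noetherian R := noetherian_mod R^o.
Definition noetherian_ring R := left_noetherian R /\ right_noetherian R.
Definition right_artinian R := artinian_mod (right_regular R).
Definition semisimple_ring R := semisimple_mod (right_regular R).

(* For a noetherian ring the left and right global dimensions coincide; this
   is the right one. *)
Definition finite_gldim R :=
  exists d, forall M : rmodType R, projdim_le M d.

Record ideal R := Ideal {
  ideal_pred : R -> bool;
  ideal_zmod_closed : zmod_closed ideal_pred;
  idealMl : forall a x, x \in ideal_pred -> a * x \in ideal_pred;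
  idealMr : forall a x, x \in ideal_pred -> x * a \in ideal_pred
}.

HB.instance Definition _ R (I : ideal R) :=
  GRing.isZmodClosed.Build R (ideal_pred I) (ideal_zmod_closed I).

Section QuotientRing.
Variables (R : pzRingType) (I : ideal R).

Definition quotring := Quotient.quot (GRing.ZmodClosed.clone R (ideal_pred I) _).
HB.instance Definition _ := Quotient.on quotring.
HB.instance Definition _ := GRing.Zmodule.on quotring.

Definition quotring_one : quotring := \pi_quotring 1.
Definition quotring_mul (x y : quotring) : quotring :=
  \pi_quotring (repr x * repr y).

Lemma quotring_eqE (x y : R) :
  (\pi_quotring x == \pi_quotring y) = (x - y \in ideal_pred I).
Proof. by rewrite -Quotient.idealrBE. Qed.

Lemma quotring_piD (x y : R) :
  \pi_quotring (x + y) = \pi_quotring x + \pi_quotring y.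
Proof. exact: Quotient.pi_add. Qed.

Lemma quotring_piM (x y : R) :
  \pi_quotring (x * y) = quotring_mul (\pi_quotring x) (\pi_quotring y).
Proof.
apply/eqP; rewrite quotring_eqE; set x' := repr _; set y' := repr _.
have -> : x * y - x' * y' = (x - x') * y + x' * (y - y').
  by rewrite mulrBl mulrBr addrA subrK.
by rewrite rpredD //; [apply: idealMr | apply: idealMl];
  rewrite -quotring_eqE reprK.
Qed.

Lemma quotring_mulA : associative quotring_mul.
Proof.
elim/quotW=> x; elim/quotW=> y; elim/quotW=> z.
rewrite -(quotring_piM x y) -(quotring_piM y z) -(quotring_piM x).
by rewrite -(quotring_piM (x * y)) mulrA.
Qed.

Lemma quotring_mul1 : left_id quotring_one quotring_mul.
Proof. by elim/quotW=> x; rewrite -quotring_piM mul1r. Qed.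

Lemma quotring_mulr1 : right_id quotring_one quotring_mul.
Proof. by elim/quotW=> x; rewrite -quotring_piM mulr1. Qed.

Lemma quotring_mulDl : left_distributive quotring_mul +%R.
Proof.
elim/quotW=> x; elim/quotW=> y; elim/quotW=> z.
by rewrite -quotring_piD -!quotring_piM mulrDl quotring_piD.
Qed.

Lemma quotring_mulDr : right_distributive quotring_mul +%R.
Proof.
elim/quotW=> x; elim/quotW=> y; elim/quotW=> z.
by rewrite -quotring_piD -!quotring_piM mulrDr quotring_piD.
Qed.

HB.instance Definition _ := GRing.Zmodule_isPzRing.Build quotring
  quotring_mulA quotring_mul1 quotring_mulr1 quotring_mulDl quotring_mulDr.

End QuotientRing.

Section GeneratedIdeal.
Variables (R : pzRingType) (c : R).

Definition gen_ideal_pred : R -> bool :=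
  fun x => `[< exists s : seq (R * R), x = \sum_(p <- s) p.1 * c * p.2 >].

Lemma gen_ideal_zmod_closed : zmod_closed gen_ideal_pred.
Proof.
split; first by apply/asboolP; exists [::]; rewrite big_nil.
move=> x y /asboolP[s ->] /asboolP[t ->]; apply/asboolP.
exists (s ++ [seq (- p.1, p.2) | p <- t]); rewrite big_cat big_map /= -sumrN.
by congr (_ + _); apply: eq_bigr => p _; rewrite !mulNr.
Qed.

Lemma gen_idealMl a x : x \in gen_ideal_pred -> a * x \in gen_ideal_pred.
Proof.
move=> /asboolP[s ->]; apply/asboolP; exists [seq (a * p.1, p.2) | p <- s].
by rewrite big_map mulr_sumr; apply: eq_bigr => p _; rewrite !mulrA.
Qed.

Lemma gen_idealMr a x : x \in gen_ideal_pred -> x * a \in gen_ideal_pred.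
Proof.
move=> /asboolP[s ->]; apply/asboolP; exists [seq (p.1, p.2 * a) | p <- s].
by rewrite big_map mulr_suml; apply: eq_bigr => p _; rewrite !mulrA.
Qed.

Definition gen_ideal : ideal R :=
  Ideal gen_ideal_zmod_closed gen_idealMl gen_idealMr.

End GeneratedIdeal.

Section LinearRad.
Variables (A : pzRingType) (M : lmodType A) (f : {linear M -> M}).

Lemma preim_submod_closed (N : submodClosed M) :
  submod_closed (fun x => f x \in N).
Proof.
split=> [|a x y Nx Ny]; rewrite unfold_in ?raddf0 ?rpred0 //.
by rewrite linearP rpredD // rpredZ.
Qed.

Lemma linear_rad x : x \in rad M -> f x \in rad M.
Proof.
move=> /radP Jx; apply/radP => N [_ maxN]; apply: contrapT => /negP Nfx.
pose K0 := fun x : M => f x \in N.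
pose aK0 := GRing.isSubmodClosed.Build A M K0 (preim_submod_closed N).
pose K : submodClosed M := HB.pack K0 aK0.
have Kx : x \in K; last by move: Nfx; rewrite -[f x \in N]/(x \in K) Kx.
apply: Jx; split=> [/(_ x)|L KL].
  by rewrite inE => /idP Kx; move/negP: Nfx; apply.
have [LK|/existsNP[y0 /not_implyP[Ly0 /negP Ky0]]] :=
  pselect (forall y, y \in L -> y \in K).
  by left=> y; apply/idP/idP; [exact: LK | exact: KL].
right=> z; rewrite inE; apply/idP.
pose S0 := fun m : M => `[< exists2 y, y \in L & m - f y \in N >].
have S0c : submod_closed S0.
  split=> [|a u v /asboolP[y Ly Nu] /asboolP[y' Ly' Nv]]; apply/asboolP.
    by exists 0; rewrite ?rpred0 // raddf0 subrr rpred0.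
  exists (a *: y + y'); first by rewrite rpredD // rpredZ.
  by rewrite linearP opprD addrACA -scalerBr rpredD // rpredZ.
pose aS0 := GRing.isSubmodClosed.Build A M S0 S0c.
pose S : submodClosed M := HB.pack S0 aS0.
have [|SN|ST] := maxN S.
- by move=> m Nm; apply/asboolP; exists 0; rewrite ?rpred0 // raddf0 subr0.
- case/negP: Ky0; rewrite -[_ \in K]/(f y0 \in N) -SN.
  by apply/asboolP; exists y0; rewrite // subrr rpred0.
have: f z \in S by rewrite ST.
move=> /asboolP[y Ly]; rewrite -raddfB => Kzy.
by rewrite -(subrK y z) rpredD // KL.
Qed.

End LinearRad.

Section JacobsonRadical.
Variable R : pzRingType.

Definition left_mul (a : R) (x : right_regular R) : right_regular R :=
  (a : R) * (x : R).

Lemma left_mul_is_linear a : linear (left_mul a).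
Proof. by move=> b x y; rewrite /left_mul mulrDr /= mulrA. Qed.

HB.instance Definition _ a := GRing.isLinear.Build R^c (right_regular R)
  (right_regular R) _ (left_mul a) (left_mul_is_linear a).

Definition jacobson_pred : R -> bool := rad_pred (right_regular R).

Lemma jacobson_zmod_closed : zmod_closed jacobson_pred.
Proof. exact: GRing.submod_closedB (rad_submod_closed (right_regular R)). Qed.

Lemma jacobsonMl a x : x \in jacobson_pred -> a * x \in jacobson_pred.
Proof. exact: (@linear_rad _ _ (left_mul a)). Qed.

Lemma jacobsonMr a x : x \in jacobson_pred -> x * a \in jacobson_pred.
Proof. exact: (@rpredZ _ _ (rad (right_regular R)) (a : R^c) x). Qed.

Definition jacobson : ideal R :=
  Ideal jacobson_zmod_closed jacobsonMl jacobsonMr.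

End JacobsonRadical.

(* R / J(R) is semisimple, and idempotents lift modulo J(R). *)
Definition semiperfect_ring R :=
  semisimple_ring (quotring (jacobson R)) /\
  forall y : quotring (jacobson R), y * y = y ->
    exists2 e : R, e * e = e & \pi_(quotring (jacobson R)) e = y.

Record idempotent_of R := Idempotent {
  idem_val :> R;
  idemP : idem_val * idem_val = idem_val
}.

Section Idempotents.
Variable R : pzRingType.
Implicit Types e f : idempotent_of R.

Lemma idem_compl_subproof e : (1 - (e : R)) * (1 - (e : R)) = 1 - (e : R).
Proof. by rewrite mulrBr mulr1 mulrBl mul1r idemP subrr subr0. Qed.

Definition idem_compl e := Idempotent (idem_compl_subproof e).

(* Since f is idempotent, fRf is the set of the x such that f x f = x. *)
Definition corner_pred f : R -> bool := fun x => (f : R) * x * (f : R) == x.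

Lemma cornerP f x : reflect (exists y, x = (f : R) * y * (f : R)) (x \in corner_pred f).
Proof.
apply: (iffP eqP) => [<-|[y ->]]; first by exists x.
by rewrite -!mulrA idemP !mulrA idemP.
Qed.

Lemma corner_zmod_closed f : zmod_closed (corner_pred f).
Proof.
split=> [|x y /eqP fx /eqP fy]; apply/eqP; first by rewrite mulr0 mul0r.
by rewrite mulrBr mulrBl fx fy.
Qed.

Lemma corner_mul_closed f :
  {in corner_pred f &, forall x y, x * y \in corner_pred f}.
Proof.
move=> _ _ /cornerP[x ->] /cornerP[y ->]; apply/cornerP.
by exists (x * (f : R) * (f : R) * y); rewrite !mulrA.
Qed.

Lemma corner_one f : (f : R) \in corner_pred f.
Proof. by apply/eqP; rewrite !idemP. Qed.

Lemma corner_mul1 f x : x \in corner_pred f -> (f : R) * x = x.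
Proof. by move=> /cornerP[y ->]; rewrite !mulrA idemP. Qed.

Lemma corner_mulr1 f x : x \in corner_pred f -> x * (f : R) = x.
Proof. by move=> /cornerP[y ->]; rewrite -!mulrA idemP. Qed.

Section CornerRing.
Variable f : idempotent_of R.

Record corner := Corner {
  corner_val :> R;
  corner_valP : corner_val \in corner_pred f
}.
HB.instance Definition _ := [isSub for corner_val].
HB.instance Definition _ := [Choice of corner by <:].
HB.instance Definition _ := GRing.SubChoice_isSubZmodule.Build
  R (corner_pred f) corner (corner_zmod_closed f).

Definition corner_ring_one : corner := Corner (corner_one f).
Definition corner_ring_mul (x y : corner) : corner :=
  Corner (corner_mul_closed (corner_valP x) (corner_valP y)).

Lemma corner_ring_mulA : associative corner_ring_mul.
Proof. by move=> x y z; apply: val_inj; rewrite /= mulrA. Qed.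

Lemma corner_ring_mul1 : left_id corner_ring_one corner_ring_mul.
Proof. by move=> x; apply: val_inj; exact: corner_mul1 (valP x). Qed.

Lemma corner_ring_mulr1 : right_id corner_ring_one corner_ring_mul.
Proof. by move=> x; apply: val_inj; exact: corner_mulr1 (valP x). Qed.

Lemma corner_ring_mulDl : left_distributive corner_ring_mul +%R.
Proof. by move=> x y z; apply: val_inj; rewrite /= mulrDl. Qed.

Lemma corner_ring_mulDr : right_distributive corner_ring_mul +%R.
Proof. by move=> x y z; apply: val_inj; rewrite /= mulrDr. Qed.

HB.instance Definition _ := GRing.Zmodule_isPzRing.Build corner
  corner_ring_mulA corner_ring_mul1 corner_ring_mulr1
  corner_ring_mulDl corner_ring_mulDr.

End CornerRing.

Definition Gamma e : pzRingType := corner (idem_compl e).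

Definition sandwiched e e' :=
  {subset corner_pred (idem_compl e) <= corner_pred (idem_compl e')}.

(* Since e is idempotent, eR is the set of the x such that e x = x. *)
Definition principal_pred e : right_regular R -> bool :=
  fun x => (e : R) * (x : R) == x.

Lemma principal_submod_closed e : submod_closed (principal_pred e).
Proof.
split=> [|a x y /eqP ex /eqP ey]; apply/eqP; first by rewrite mulr0.
by rewrite mulrDr ey /= mulrA ex.
Qed.

HB.instance Definition _ e := GRing.isSubmodClosed.Build R^c (right_regular R)
  (principal_pred e) (principal_submod_closed e).

Definition principal_submod e : submodClosed (right_regular R) :=
  GRing.SubmodClosed.clone R^c (right_regular R) (principal_pred e) _.

Definition principal e : rmodType R := submod (principal_submod e).

(* S_e = eR / rad eR *)
Definition top_mod e : rmodType R := quotmod (rad (principal e)).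

Definition primitive_idem e :=
  (e : R) != 0 /\
  forall f g, (f : R) * (g : R) = 0 -> (g : R) * (f : R) = 0 ->
    (e : R) = (f : R) + (g : R) -> (f : R) = 0 \/ (g : R) = 0.

End Idempotents.

(* 1 is a sum of pairwise orthogonal primitive idempotents e_i such that the
   right modules e_i R are pairwise non-isomorphic. *)
Definition basic_ring R :=
  exists n (e : 'I_n -> idempotent_of R),
    [/\ forall i, primitive_idem (e i),
        forall i j, i != j -> (e i : R) * (e j : R) = 0,
        \sum_i (e i : R) = 1
      & forall i j, i != j -> ~ iso_mod (principal (e i)) (principal (e j))].

End Rings.

Definition direct_decomposition (A : pzRingType) (M : lmodType A) (n : nat)
    (S : 'I_n -> submodClosed M) :=
  bijective (fun s : forall i, submod (S i) => \sum_i (val (s i) : M)).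

(* Main.v *)
Require Import Defs.
From HB Require Import structures.
From mathcomp Require Import all_boot all_order all_algebra.
From mathcomp Require Import boolp functions.

Set Implicit Arguments.
Unset Strict Implicit.
Unset Printing Implicit Defensive.

Import GRing.Theory.
Local Open Scope ring_scope.
Local Open Scope quotient_scope.

(** Write 1 as a sum of orthogonal primitive idempotents eps_i such that e is
    the sum of the eps_i with i in a set I; up to conjugation every decomposition
    has this form ([basic_system_adapted]).  Let S_i be the simple module
    belonging to eps_i.  Draw an arrow from i to j when Ext^k(S_i, S_j) is
    nonzero for some k > 0.  The theorem says that the elements of I can be
    listed so that all arrows point forward, that is, that the graph on I has no
    cycle and no loop.  By removing sinks one after the
    other ([sink_order]), it is enough to find in every nonempty subset of I a
    vertex without arrows into that subset ([Ext_sink]).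

    Suppose that a subset has no such vertex.  A minimal sinkless subset J is a
    chordless cycle ([minimal_sinkless]): there is a permutation s of J with
    arrows from l to s l, and no other arrows inside J.  Put e_J for the sum of
    the eps_l with l in J and f = 1 - e_J, so that fRf is sandwiched.

    Finite global dimension of fRf says how far an R-module is from being
    generated by f.  A noetherian module M has a finite complex of projective
    modules ending in M whose terms Q other than M satisfy Hom(Q, N) = 0 as soon
    as Nf = 0, and whose homology is killed by f ([relative_resolution_exists]):
    resolve Mf over fRf and induce up.  For f = 1 this is a projective
    resolution over R, so there is a largest degree p_l with
    Ext^(p_l)(S_l, S_(s l)) nonzero, and p_l > 0.  For f = 1 - e_J and M = R it
    is a complex C with homology modules H_t, built from the S_l with l in J
    because R/<1-e> is right artinian ([isotypic_layers]); and since the terms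
    other than R have no maps to S_m, every Ext^k(C, S_m) with k > 0 vanishes.

    On the other hand, a factor S_l of H_t contributes Ext^(p_l)(S_l, S_(s l)) to
    degree p_l + t of Ext(C, S_(s l)).  Filter C by its highest homology modules
    and these by submodules, and consider the first factor for which p_l + t
    takes its maximal value N.  Its contribution can only be cancelled by degree
    N - 1 of an earlier factor with a nonzero Ext into S_(s l).  This factor is
    not S_l, since it would be a better choice, so it is S_(s l) in degree 0; but
    then p_(s l) + (N - 1) is at least N, and this contradicts the choice as
    well.  Hence all H_t are 0, and R is the image of a module without maps to
    S_l: this is absurd, as R maps onto S_l ([relative_resolution_Hom]).  The
    comparison of degrees is carried out one term of the complex at a time, with
    the long exact sequence in the form of three rules about vanishing
    ([Ext_mid], [Ext_left], [Ext_right]); the induction hypothesis is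
    [Ext_gap2]. *)

(** * Linear maps and submodules *)

Section LinearMaps.
Variable A : pzRingType.
Implicit Types M N K E P : lmodType A.

Definition linear_of M N (g : M -> N) (h : linear g) : {linear M -> N} :=
  HB.pack g (GRing.isLinear.Build A M N _ g h).

(** A linear map may be defined by an additive relation that is total and
    relates 0 to 0 only; this is how maps out of quotients, into submodules and
    out of free or cyclic modules are obtained below. *)
Lemma linear_graph M N (r : M -> N -> Prop) :
  (forall x, exists y, r x y) ->
  (forall a x y x' y', r x y -> r x' y' -> r (a *: x + x') (a *: y + y')) ->
  (forall y, r 0 y -> y = 0) ->
  exists g : {linear M -> N}, forall x y, r x y <-> g x = y.
Proof.
move=> tot lin fun0; have [g0 rg] := choice tot.
have uniq x y y' : r x y -> r x y' -> y = y'.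
  move=> rxy rxy'; apply/subr0_eq/fun0.
  by have := lin (-1) _ _ _ _ rxy' rxy; rewrite !scaleN1r addNr addrC.
have glin : linear g0 by move=> a x y; apply: uniq (rg _) (lin _ _ _ _ _ _ _).
by exists (linear_of glin) => x y; split=> [rxy|<-//]; apply: uniq rxy.
Qed.

Lemma factor_surj M N E (q : {linear E -> M}) (g : {linear E -> N}) :
  (forall x, exists y, q y = x) -> (forall y, q y = 0 -> g y = 0) ->
  exists h : {linear M -> N}, forall y, h (q y) = g y.
Proof.
move=> qs gq; have [|||h hE] := @linear_graph M N (fun x z => exists2 y, q y = x & g y = z).
- by move=> x; have [y <-] := qs x; exists (g y), y.
- by move=> a _ _ _ _ [y <- <-] [y' <- <-]; exists (a *: y + y'); rewrite linearP.
- by move=> _ [y qy <-]; apply: gq.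
by exists h => y; apply/hE; exists y.
Qed.

Lemma factor_inj M N E (i : {linear M -> E}) (g : {linear N -> E}) :
  injective i -> (forall x, exists y, i y = g x) ->
  exists h : {linear N -> M}, forall x, i (h x) = g x.
Proof.
move=> ii gi; have [|||h hE] := @linear_graph N M (fun x z => i z = g x) => //.
- by move=> a x y x' y' E1 E2; rewrite !linearP E1 E2.
- by move=> y; rewrite linear0 => iy; apply: ii; rewrite linear0.
by exists h => y; apply/hE.
Qed.

Definition subm_pred M (X : M -> Prop) : M -> bool := fun x => `[< X x >].

Definition submP_closed M (X : M -> Prop) :=
  X 0 /\ forall a x y, X x -> X y -> X (a *: x + y).

Lemma subm_closed M (X : M -> Prop) :
  submP_closed X -> submod_closed (subm_pred X).
Proof.
move=> [X0 XD]; split; first exact/asboolP.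
by move=> a x y /asboolP Xx /asboolP Xy; apply/asboolP/XD.
Qed.

Definition subm M (X : M -> Prop) (h : submP_closed X) : submodClosed M :=
  HB.pack (subm_pred X) (GRing.isSubmodClosed.Build A M (subm_pred X) (subm_closed h)).

Lemma submP M (X : M -> Prop) (h : submP_closed X) x :
  reflect (X x) (x \in subm h).
Proof. exact: asboolP. Qed.

Lemma submB M (L : submodClosed M) x y : x \in L -> y \in L -> x - y \in L.
Proof. by move=> Lx Ly; rewrite rpredD // -scaleN1r rpredZ. Qed.

Lemma zero_closed M : submP_closed (fun x : M => x = 0).
Proof. by split=> // a x y -> ->; rewrite scaler0 addr0. Qed.

Lemma image_closed M N (g : {linear M -> N}) :
  submP_closed (fun y => exists x, g x = y).
Proof.
split=> [|a _ _ [x <-] [y <-]]; first by exists 0; rewrite linear0.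
by exists (a *: x + y); rewrite linearP.
Qed.

Lemma preimage_closed M N (g : {linear M -> N}) (L : submodClosed N) :
  submP_closed (fun x => g x \in L).
Proof.
split=> [|a x y gx gy]; first by rewrite linear0 rpred0.
by rewrite linearP rpredD // rpredZ.
Qed.

Lemma kernel_closed M N (g : {linear M -> N}) : submP_closed (fun x => g x = 0).
Proof.
split=> [|a x y gx gy]; first by rewrite linear0.
by rewrite linearP gx gy scaler0 addr0.
Qed.

Definition zero_sub M := subm (zero_closed M).
Definition image_sub M N (g : {linear M -> N}) := subm (image_closed g).
Definition preimage_sub M N (g : {linear M -> N}) L := subm (preimage_closed g L).
Definition kernel_sub M N (g : {linear M -> N}) := subm (kernel_closed g).

Lemma zero_subP M x : reflect (x = 0) (x \in zero_sub M).
Proof. exact: submP. Qed.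

Lemma image_subP M N (g : {linear M -> N}) y :
  reflect (exists x, g x = y) (y \in image_sub g).
Proof. exact: submP. Qed.

Lemma preimage_subP M N (g : {linear M -> N}) (L : submodClosed N) x :
  reflect (g x \in L) (x \in preimage_sub g L).
Proof. exact: submP. Qed.

Lemma kernel_subP M N (g : {linear M -> N}) x :
  reflect (g x = 0) (x \in kernel_sub g).
Proof. exact: submP. Qed.

Definition submod_incl M (N : submodClosed M) : {linear submod N -> M} := val.

Lemma submod_mem M (N : submodClosed M) (x : submod N) : val x \in N.
Proof. exact: (submod_valP x). Qed.

Lemma zero_val M (x : submod (zero_sub M)) : x = 0.
Proof. by apply: val_inj; apply/zero_subP/submod_mem. Qed.

Lemma kernel_val M N (g : {linear M -> N}) (x : submod (kernel_sub g)) :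
  g (val x) = 0.
Proof. exact/kernel_subP/submod_mem. Qed.

Lemma submod_inclBZ M (N : submodClosed M) (x y : submod N) a :
  submod_incl N (x - a *: y) = val x - a *: val y.
Proof. by rewrite linearB linearZ. Qed.

Lemma submod_incl_inj M (N : submodClosed M) : injective (@submod_incl M N).
Proof. exact: val_inj. Qed.

Lemma submod_inclP M (N : submodClosed M) x :
  reflect (exists y, @submod_incl M N y = x) (x \in N).
Proof.
apply: (iffP idP) => [Nx|[y <-]]; first by exists (Submod Nx).
exact: (submod_valP y).
Qed.

Definition quotmod_pi M (N : submodClosed M) (x : M) : quotmod N := \pi_(quotmod N) x.

Lemma quotmod_pi_linear M (N : submodClosed M) : linear (@quotmod_pi M N).
Proof. by move=> a x y; rewrite /quotmod_pi quotmod_piD quotmod_piZ. Qed.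

HB.instance Definition _ M (N : submodClosed M) :=
  GRing.isLinear.Build A M (quotmod N) _ (@quotmod_pi M N) (@quotmod_pi_linear M N).

Lemma quotmod_pi_eq0 M (N : submodClosed M) x : quotmod_pi N x = 0 <-> x \in N.
Proof.
have <- : (quotmod_pi N x == quotmod_pi N 0) = (x \in N).
  by rewrite /quotmod_pi quotmod_eqE subr0.
by rewrite linear0; split=> [->|/eqP].
Qed.

Lemma quotmod_pi_surj M (N : submodClosed M) (y : quotmod N) :
  exists x, quotmod_pi N x = y.
Proof. by exists (repr y); rewrite /quotmod_pi reprK. Qed.

(** * Short exact sequences *)

Definition ses M E N (i : {linear M -> E}) (p : {linear E -> N}) :=
  [/\ injective i, forall y, exists x, p x = y
    & forall x, p x = 0 <-> exists z, i z = x].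

Lemma ses_kernel E N (p : {linear E -> N}) :
  (forall y, exists x, p x = y) -> ses (submod_incl (kernel_sub p)) p.
Proof.
move=> ps; split=> //.
by move=> x; split=> [/kernel_subP/submod_inclP //|
  /submod_inclP/kernel_subP].
Qed.

Lemma ses_quot M (N : submodClosed M) : ses (submod_incl N) (quotmod_pi N).
Proof.
split; [exact: submod_incl_inj | exact: quotmod_pi_surj |].
by move=> x; rewrite quotmod_pi_eq0; split=> /submod_inclP.
Qed.

Lemma corestrict M N (g : {linear M -> N}) (L : submodClosed N) :
  (forall x, g x \in L) ->
  exists h : {linear M -> submod L}, forall x, val (h x) = g x.
Proof.
move=> gL; apply: (@factor_inj _ _ _ (submod_incl L)) => [|x].
  exact: submod_incl_inj.
exact/submod_inclP.
Qed.

(** A presentation of the middle term of a short exact sequence also presents the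
    last term; this compares the two kernels. *)
Lemma ses_comp_kernel K P M M' N (j : {linear K -> P}) (q : {linear P -> M})
    (i : {linear M' -> M}) (p : {linear M -> N}) :
  ses j q -> ses i p ->
  exists (L : lmodType A) (l : {linear L -> P}) (k : {linear K -> L})
    (r : {linear L -> M'}),
    [/\ ses l (p \o q), ses k r, forall x, l (k x) = j x
      & forall x, i (r x) = q (l x)].
Proof.
move=> [ji qs qE] [ii ps pE].
pose pq : {linear P -> N} := p \o q.
have Lpq x : p (q x) = 0 -> x \in kernel_sub pq by move=> h; apply/submP.
have Lpq' (x : submod (kernel_sub pq)) : p (q (val x)) = 0.
  exact: (@kernel_val _ _ pq x).
have [|k kE] := @corestrict K P j (kernel_sub pq).
  by move=> x; apply: Lpq; have -> : q (j x) = 0; [apply/qE; exists x|rewrite linear0].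
have [x|r rE] := @factor_inj M' (submod (kernel_sub pq)) M i
    (q \o submod_incl (kernel_sub pq)) ii.
  by apply/pE; exact: Lpq'.
exists (submod (kernel_sub pq)), (submod_incl (kernel_sub pq)), k, r; split=> //.
- by apply: ses_kernel => y; have [x <-] := ps y; have [z <-] := qs x; exists z.
- split.
  + by move=> x y /(congr1 val); rewrite !kE => /ji.
  + move=> y; have [x qx] := qs (i y).
    have Lx : x \in kernel_sub pq by apply: Lpq; rewrite qx; apply/pE; exists y.
    by exists (Submod Lx); apply: ii; rewrite rE.
  + move=> x; split=> [rx|[z <-]].
      have /qE[z jz] : q (val x) = 0 by rewrite -[LHS]rE rx linear0.
      by exists z; apply: val_inj; rewrite kE.
    by apply: ii; rewrite rE linear0 /= kE; apply/qE; exists z.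
Qed.

End LinearMaps.

(** * Projective modules *)

Section Projectives.
Variable A : pzRingType.
Implicit Types M N P Q : lmodType A.

Lemma projective_zero P : (forall x : P, x = 0) -> projective_mod P.
Proof.
move=> P0 M N f g fs.
pose z : {linear P -> M} := \0.
by exists z => x; rewrite (P0 x) !linear0.
Qed.

Lemma pair_inl_linear M N : linear (fun x : M => (x, 0 : N)).
Proof. by move=> a x y; congr pair; rewrite /= scaler0 addr0. Qed.

Lemma pair_inr_linear M N : linear (fun y : N => (0 : M, y)).
Proof. by move=> a x y; congr pair; rewrite /= scaler0 addr0. Qed.

Definition pair_inl M N : {linear M -> (M * N)%type} := linear_of (@pair_inl_linear M N).
Definition pair_inr M N : {linear N -> (M * N)%type} := linear_of (@pair_inr_linear M N).

Lemma pullback M N P (p : {linear M -> P}) (q : {linear N -> P}) :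
  exists (W : lmodType A) (a : {linear W -> M}) (b : {linear W -> N}),
    [/\ forall w, p (a w) = q (b w),
        forall w, a w = 0 -> b w = 0 -> w = 0,
        forall x y, p x = q y -> exists w, a w = x /\ b w = y
      & forall (L : lmodType A) (u : {linear L -> M}) (v : {linear L -> N}),
          (forall x, p (u x) = q (v x)) ->
          exists t : {linear L -> W}, forall x, a (t x) = u x /\ b (t x) = v x].
Proof.
pose d : {linear (M * N)%type -> P} := (p \o fst) \- (q \o snd).
pose W := kernel_sub d.
have WP z : reflect (p z.1 = q z.2) (z \in W).
  apply: (iffP (@kernel_subP _ _ _ _ _)) => [/subr0_eq //|E].
  by rewrite -[d z]/(p z.1 - q z.2) E subrr.
exists (submod W), (fst \o submod_incl W), (snd \o submod_incl W); split.
- by move=> w; apply/WP/(submod_valP w).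
- move=> w w1 w2; apply: val_inj; rewrite linear0; move: w1 w2 => /=.
  by rewrite /submod_incl; case: (val w) => x y /= -> ->.
- by move=> x y /(WP (x, y)) Wxy; exists (Submod Wxy).
move=> L u v uv.
pose z : {linear L -> (M * N)%type} := (@pair_inl M N \o u) \+ (@pair_inr M N \o v).
have zE x : z x = (u x, v x).
  by congr pair; rewrite /= ?addr0 ?add0r.
have [|t tE] := @corestrict _ _ _ z W; first by move=> x; apply/WP; rewrite zE uv.
by exists t => x; rewrite /= !tE zE.
Qed.

Lemma projective_prod P Q :
  projective_mod P -> projective_mod Q -> projective_mod (P * Q)%type.
Proof.
move=> pP pQ M N f g fs.
have [h hE] := pP _ _ f (g \o @pair_inl P Q) fs.
have [k kE] := pQ _ _ f (g \o @pair_inr P Q) fs.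
exists ((h \o fst) \+ (k \o snd)) => -[x y].
transitivity (f (h x + k y)); first by [].
rewrite linearD hE kE /= -linearD; congr (g _).
by congr pair; rewrite /= ?addr0 ?add0r.
Qed.

Lemma projective_retract P Q (i : {linear P -> Q}) (r : {linear Q -> P}) :
  (forall x, r (i x) = x) -> projective_mod Q -> projective_mod P.
Proof.
move=> ri pQ M N f g fs; have [h hE] := pQ _ _ f (g \o r) fs.
by exists (h \o i) => x /=; rewrite hE /= ri.
Qed.

Lemma projective_split P N (q : {linear P -> N}) : projective_mod N ->
  (forall y, exists x, q x = y) -> exists s : {linear N -> P}, forall y, q (s y) = y.
Proof. by move=> pN qs; have [s sE] := pN _ _ q idfun qs; exists s. Qed.

Section FreeModule.
Variable X : choiceType.

(** The free module on [X] is the span of the indicator functions inside the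
    module of all functions from [X] to [A]. *)
Definition basis_vector (x : X) : X -> A^o := fun y => (x == y)%:R.

Definition free_comb (s : seq (A * X)) : X -> A^o :=
  \sum_(u <- s) (u.1 : A) *: basis_vector u.2.

Lemma free_closed : submP_closed (fun v : X -> A^o => exists s, v = free_comb s).
Proof.
split=> [|a _ _ [s ->] [t ->]]; first by exists [::]; rewrite /free_comb big_nil.
exists ([seq (a * u.1, u.2) | u <- s] ++ t).
rewrite /free_comb big_cat big_map scaler_sumr; congr (_ + _).
by apply: eq_bigr => u _; rewrite scalerA.
Qed.

Definition free_mod : lmodType A := submod (subm free_closed).

Lemma free_mod_comb (v : free_mod) : exists s, val v = free_comb s.
Proof. exact: (elimT (submP free_closed _) (submod_valP v)). Qed.

Lemma free_basis_subproof x : basis_vector x \in subm free_closed.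
Proof.
by apply/submP; exists [:: (1, x)]; rewrite /free_comb big_seq1 scale1r.
Qed.

Definition free_basis x : free_mod := Submod (free_basis_subproof x).

(** Grouping the terms of a combination by basis vector, each group has the
    value of the combination at that vector as coefficient. *)
Lemma free_comb_eval (N : lmodType A) (g : X -> N) s :
  free_comb s = 0 -> \sum_(u <- s) (u.1 : A) *: g u.2 = 0.
Proof.
move=> s0; pose t := undup [seq u.2 | u <- s].
transitivity (\sum_(u <- s) \sum_(x <- t) ((u.1 : A) * (u.2 == x)%:R) *: g x).
  rewrite big_seq [RHS]big_seq; apply: eq_bigr => u us.
  rewrite (bigD1_seq u.2) ?undup_uniq //=; last by rewrite mem_undup map_f.
  rewrite eqxx mulr1 big1 ?addr0 // => x /negbTE; rewrite eq_sym => ->.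
  by rewrite mulr0 scale0r.
rewrite exchange_big big1 // => x _; rewrite -scaler_suml.
have := congr1 (@^~ x) s0; rewrite /free_comb fct_sumE => sx.
by rewrite [X in X *: _]sx scale0r.
Qed.

Lemma free_mod_map (N : lmodType A) (g : X -> N) :
  exists h : {linear free_mod -> N}, forall x, h (free_basis x) = g x.
Proof.
have [|||h hE] := @linear_graph _ free_mod N (fun v y =>
  exists2 s, val v = free_comb s & y = \sum_(u <- s) (u.1 : A) *: g u.2).
- by move=> v; have [s sE] := free_mod_comb v; eexists; exists s.
- move=> a x y x' y' [s xs ->] [t x't ->].
  exists ([seq (a * u.1, u.2) | u <- s] ++ t).
    rewrite linearP /= xs x't /free_comb big_cat big_map scaler_sumr; congr (_ + _).
    by apply: eq_bigr => u _; rewrite scalerA.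
  rewrite big_cat big_map scaler_sumr; congr (_ + _).
  by apply: eq_bigr => u _; rewrite scalerA.
- by move=> y [s s0 ->]; apply: free_comb_eval.
exists h => x; apply/hE; exists [:: (1, x)].
  by rewrite /free_comb big_seq1 scale1r.
by rewrite big_seq1 scale1r.
Qed.

Lemma free_mod_ext (N : lmodType A) (h k : {linear free_mod -> N}) :
  (forall x, h (free_basis x) = k (free_basis x)) -> h =1 k.
Proof.
move=> hk v; have [s sE] := free_mod_comb v.
have -> : v = \sum_(u <- s) (u.1 : A) *: free_basis u.2.
  apply: val_inj; rewrite linear_sum sE /free_comb.
  by apply: eq_bigr => u _; rewrite linearZ.
by rewrite !linear_sum; apply: eq_bigr => u _; rewrite !linearZ /= hk.
Qed.

Lemma free_mod_projective : projective_mod free_mod.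
Proof.
move=> M N f g fs; have [m mE] := choice (fun x => fs (g (free_basis x))).
have [h hE] := free_mod_map m; exists h => v.
by apply: (@free_mod_ext N (f \o h) g) => x /=; rewrite hE mE.
Qed.

End FreeModule.

Lemma enough_projectives M : exists (K P : lmodType A) (i : {linear K -> P})
  (p : {linear P -> M}), projective_mod P /\ ses i p.
Proof.
have [p pE] := @free_mod_map M M id.
exists (submod (kernel_sub p)), (free_mod M), (submod_incl _), p.
split; first exact: free_mod_projective.
by apply: ses_kernel => y; exists (free_basis y); rewrite pE.
Qed.

End Projectives.

(** * Vanishing of Ext *)

Section ExtVanishing.
Variable A : pzRingType.
Implicit Types M N K E P B C F L : lmodType A.

Definition extends K E N (i : {linear K -> E}) :=
  forall g : {linear K -> N}, exists h : {linear E -> N}, forall x, h (i x) = g x.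

Definition Ext1_vanishes M N :=
  forall K E (i : {linear K -> E}) (p : {linear E -> M}), ses i p -> extends N i.

(** The condition in degree one ranges over all presentations of [M], the
    higher ones shift dimension along projective presentations.  In this form
    the vanishing of Ext can be used with any presentation at hand, and the
    rules of the long exact sequence need no comparison of resolutions. *)
Fixpoint Ext_vanishes (k : nat) M N : Prop :=
  match k with
  | 0 => forall (g : {linear M -> N}) x, g x = 0
  | 1 => Ext1_vanishes M N
  | k'.+1 => forall K P (i : {linear K -> P}) (p : {linear P -> M}),
      projective_mod P -> ses i p -> Ext_vanishes k' K N
  end.

Lemma Ext1_projective P N : projective_mod P -> Ext1_vanishes P N.
Proof.
move=> pP K E i p [ii ps pE] g; have [s sp] := projective_split pP ps.
pose t : {linear E -> E} := idfun \- (s \o p).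
have tE x : t x = x - s (p x) by [].
have [|r rE] := @factor_inj _ _ _ _ i t ii.
  by move=> x; apply/pE; rewrite tE linearB sp subrr.
exists (g \o r) => x /=; congr (g _); apply: ii; rewrite rE tE.
by have -> : p (i x) = 0; [apply/pE; exists x | rewrite linear0 subr0].
Qed.

(** A map out of the kernel of another presentation of [M] is first extended to
    the pullback of the two presentations, then corrected by a map on [E]: in
    other words Ext^1(M, N) is the cokernel of Hom(E, N) -> Hom(K, N) as soon
    as Ext^1(E, N) vanishes. *)
Lemma Ext1_vanishes_presentation M N K E (i : {linear K -> E}) (p : {linear E -> M}) :
  ses i p -> Ext1_vanishes E N -> extends N i -> Ext1_vanishes M N.
Proof.
move=> [ii ps pE] EN exti L F j q [ji qs qE] g.
have [W [a [b [Wab W0 Wp Wu]]]] := pullback p q.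
have [|l lE] := Wu _ (\0 : {linear L -> E}) j.
  by move=> x; rewrite linear0; apply/esym/qE; exists x.
have [|k kE] := Wu _ i (\0 : {linear K -> F}).
  by move=> x; rewrite linear0; apply/pE; exists x.
have [|G GE] := EN _ _ l a _ g.
  split.
  - by move=> x y /(congr1 b); rewrite !(lE _).2 => /ji.
  - by move=> x; have [y qy] := qs (p x); have [w [wx _]] := Wp x y (esym qy); exists w.
  - move=> w; split=> [aw|[z <-]]; last by rewrite (lE z).1.
    have /qE[z jz] : q (b w) = 0 by rewrite -Wab aw linear0.
    exists z; apply/eqP; rewrite -subr_eq0; apply/eqP/W0.
      by rewrite linearB aw (lE z).1 subrr.
    by rewrite linearB (lE z).2 jz subrr.
have [phi phiE] := exti (G \o k).
have [w|w bw|h hE] := @factor_surj _ _ _ _ b (G \- (phi \o a)).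
- by have [x px] := ps (q w); have [v [_ vb]] := Wp x w px; exists v.
- have /pE[z iz] : p (a w) = 0 by rewrite Wab bw linear0.
  suff -> : w = k z by rewrite /= (kE z).1 phiE /= subrr.
  apply/eqP; rewrite -subr_eq0; apply/eqP/W0.
    by rewrite linearB (kE z).1 iz subrr.
  by rewrite linearB (kE z).2 bw subrr.
exists h => x; rewrite -(lE x).2 hE /= GE.
by rewrite (lE x).1 linear0 subr0.
Qed.

Lemma Ext_projective k P N : projective_mod P -> Ext_vanishes k.+1 P N.
Proof.
elim: k P => [|k IH] P pP; first exact: Ext1_projective.
move=> K Q j q pQ [ji qs qE]; apply: IH.
have [s sq] := projective_split pP qs.
have [|r rE] := @factor_inj _ _ _ _ j (idfun \- (s \o q)) ji.
  by move=> x; apply/qE; rewrite /= linearB sq subrr.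
apply: (projective_retract (i := j) (r := r)) pQ => x; apply: ji.
by rewrite rE /=; have -> : q (j x) = 0; [apply/qE; exists x | rewrite linear0 subr0].
Qed.

Lemma ses_prod M P : ses (@pair_inl A M P) (snd : {linear (M * P)%type -> P}).
Proof.
split; [by move=> x y [] | by move=> y; exists (0, y) |].
by move=> [x y]; split=> [/= ->|[z [_ <-]]] //; exists x.
Qed.

(** Lift [P -> C] to [P -> B]: together with [i] it presents [B], with the same
    kernel as [P -> C]. *)
Lemma ses_rotate M B C K P (i : {linear M -> B}) (p : {linear B -> C})
    (j : {linear K -> P}) (q : {linear P -> C}) :
  ses i p -> ses j q -> projective_mod P ->
  exists (t : {linear K -> (M * P)%type}) (v : {linear (M * P)%type -> B}), ses t v.
Proof.
move=> [ii ps pE] [ji qs qE] pP; have [u uE] := pP _ _ p q ps.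
have [|c cE] := @factor_inj _ _ _ _ i (\- (u \o j)) ii.
  by move=> z; apply/pE; rewrite /= linearN uE (proj2 (qE _)) ?oppr0 //; exists z.
pose t : {linear K -> (M * P)%type} := (@pair_inl A M P \o c) \+ (@pair_inr A M P \o j).
exists t, ((i \o fst) \+ (u \o snd)).
have tE z : t z = (c z, j z).
  by congr pair; rewrite /= ?addr0 ?add0r.
split.
- by move=> x y txy; have [_ /ji] := etrans (esym (tE x)) (etrans txy (tE y)).
- move=> y; have [x qx] := qs (p y).
  have /pE[z iz] : p (y - u x) = 0 by rewrite linearB uE qx subrr.
  by exists (z, x); rewrite /= iz subrK.
- move=> [x y]; split=> [/= E|[z]].
    have /qE[z jz] : q y = 0.
      rewrite -uE; have -> : u y = i (- x).
        by rewrite linearN; apply/eqP; rewrite -addr_eq0 addrC E.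
      by apply/pE; exists (- x).
    exists z; apply: (etrans (tE z)); rewrite jz; congr pair; apply: ii.
    by rewrite cE /= jz; apply/eqP; rewrite eq_sym -addr_eq0 E.
  move=> tz; have [<- <-] := etrans (esym (tE z)) tz.
  by rewrite /= cE /= addNr.
Qed.

(** The three rules are proved together by induction on the degree.  Above the
    lowest degrees, each one follows from others applied to sequences of kernels,
    so that no resolution of a whole short exact sequence is needed:
    - middle term: a presentation of the middle term presents the last term too,
      and the two kernels differ by the first term ([ses_comp_kernel]);
    - first term: the same sequence of kernels, for a projective presentation of
      the middle term;
    - last term: rotate the sequence ([ses_rotate]). *)
Section LongExactSequence.
Variable N : lmodType A.

Let mid k := forall M B C (i : {linear M -> B}) (p : {linear B -> C}), ses i p ->
  Ext_vanishes k M N -> Ext_vanishes k C N -> Ext_vanishes k B N.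
Let left_ k := forall M B C (i : {linear M -> B}) (p : {linear B -> C}), ses i p ->
  Ext_vanishes k B N -> Ext_vanishes k.+1 C N -> Ext_vanishes k M N.
Let right_ k := forall M B C (i : {linear M -> B}) (p : {linear B -> C}), ses i p ->
  Ext_vanishes k M N -> Ext_vanishes k.+1 B N -> Ext_vanishes k.+1 C N.

Lemma mid0 : mid 0.
Proof.
move=> M B C i p [ii ps pE] M0 C0 g y.
have [z /pE[x <-]|h hE] := @factor_surj _ _ _ _ p g ps.
  exact: (M0 (g \o i)).
by rewrite -hE C0.
Qed.

Lemma left0 : left_ 0.
Proof. by move=> M B C i p sip B0 C1 g x; have [h <-] := C1 _ _ _ _ sip g. Qed.

Lemma right0 : right_ 0.
Proof.
move=> M B C i p sip M0 B1; apply: (Ext1_vanishes_presentation sip) => // g.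
by exists \0 => x; rewrite M0.
Qed.

Lemma mid1 : mid 1.
Proof.
move=> M B C i p sip M1 C1 K E j q sjq g.
have [L [l [k [r [slp skr lk _]]]]] := ses_comp_kernel sjq sip.
have [g' g'E] := M1 _ _ _ _ skr g; have [h hE] := C1 _ _ _ _ slp g'.
by exists h => x; rewrite -lk hE.
Qed.

Lemma left1 : left_ 1.
Proof.
move=> M B C i p sip B1 C2.
have [K [P [j [q [pP sjq]]]]] := enough_projectives B.
have [L [l [k [r [slp skr lk _]]]]] := ses_comp_kernel sjq sip.
apply: (Ext1_vanishes_presentation skr); first exact: C2 slp.
move=> g; have [h hE] := B1 _ _ _ _ sjq g; exists (h \o l) => x /=.
by rewrite lk.
Qed.

Lemma mid_step k : left_ k.+1 -> mid k.+2.
Proof.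
move=> lk M B C i p sip M2 C2 K P j q pP sjq.
have [L [l [u [r [slp sur _ _]]]]] := ses_comp_kernel sjq sip.
exact: lk sur (C2 _ _ _ _ pP slp) M2.
Qed.

Lemma left_step k : right_ k.+1 -> left_ k.+2.
Proof.
move=> rk M B C i p sip B2 C3.
have [K [P [j [q [pP sjq]]]]] := enough_projectives B.
have [L [l [u [r [slp sur _ _]]]]] := ses_comp_kernel sjq sip.
exact: rk sur (B2 _ _ _ _ pP sjq) (C3 _ _ _ _ pP slp).
Qed.

Lemma right_step k : mid k.+1 -> left_ k.+1 -> right_ k.+1.
Proof.
move=> mk lk M B C i p sip Mk Bk K P j q pP sjq.
have [t [v stv]] := ses_rotate sip sjq pP.
by apply: lk stv _ Bk; apply: mk (ses_prod M P) Mk _; apply: Ext_projective.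
Qed.

Lemma long_exact_sequence k : [/\ mid k, left_ k & right_ k].
Proof.
case: k => [|k]; first by split; [exact: mid0 | exact: left0 | exact: right0].
have [] : mid k.+1 /\ left_ k.+1; last by split=> //; apply: right_step.
elim: k => [|k [mk lk]]; first by split; [exact: mid1 | exact: left1].
by split; [exact: mid_step | apply: left_step; apply: right_step].
Qed.

Lemma Ext_mid k M B C (i : {linear M -> B}) (p : {linear B -> C}) : ses i p ->
  Ext_vanishes k M N -> Ext_vanishes k C N -> Ext_vanishes k B N.
Proof. by have [m _ _] := long_exact_sequence k; apply: m. Qed.

Lemma Ext_left k M B C (i : {linear M -> B}) (p : {linear B -> C}) : ses i p ->
  Ext_vanishes k B N -> Ext_vanishes k.+1 C N -> Ext_vanishes k M N.
Proof. by have [_ l _] := long_exact_sequence k; apply: l. Qed.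

Lemma Ext_right k M B C (i : {linear M -> B}) (p : {linear B -> C}) : ses i p ->
  Ext_vanishes k M N -> Ext_vanishes k.+1 B N -> Ext_vanishes k.+1 C N.
Proof. by have [_ _ r] := long_exact_sequence k; apply: r. Qed.

End LongExactSequence.

Lemma Ext_zero k M N : (forall x : M, x = 0) -> Ext_vanishes k M N.
Proof.
move=> M0; case: k => [g x|k]; first by rewrite (M0 x) linear0.
exact/Ext_projective/projective_zero.
Qed.

Lemma Ext_surj0 M B N (p : {linear M -> B}) : (forall y, exists x, p x = y) ->
  Ext_vanishes 0 M N -> Ext_vanishes 0 B N.
Proof. by move=> ps M0 g y; have [x <-] := ps y; apply: (M0 (g \o p)). Qed.

(** Pulling a surjection back along a map out of [P] gives an extension of [P],
    which splits. *)
Lemma Ext1_all_projective P :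
  (forall N, Ext_vanishes 1 P N) -> projective_mod P.
Proof.
move=> P1 M N f g fs.
have [W [a [b [Wab W0 Wp Wu]]]] := pullback f g.
have bs y : exists w, b w = y.
  by have [x fx] := fs (g y); have [w [_ wy]] := Wp x y fx; exists w.
have [r rE] := P1 _ _ _ _ _ (ses_kernel bs) idfun.
have [w bw|s sE] := @factor_surj _ _ _ _ b (idfun \- (submod_incl (kernel_sub b) \o r)) bs.
  have /submod_inclP[z zw] : w \in kernel_sub b by apply/submP.
  by rewrite /= -zw rE subrr.
exists (a \o s) => y /=; have [w <-] := bs y; rewrite sE /=.
by rewrite Wab linearB [b (submod_incl _ _)]kernel_val subr0.
Qed.

(** * Resolutions *)

Lemma exact_syzygy B C M (u : {linear B -> C}) (v : {linear C -> M}) :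
  (forall y, v y = 0 <-> exists x, u x = y) ->
  exists q : {linear B -> submod (kernel_sub v)},
    (forall x, val (q x) = u x) /\ ses (submod_incl (kernel_sub u)) q.
Proof.
move=> uv; have [|q qE] := @corestrict _ _ _ u (kernel_sub v).
  by move=> x; apply/submP/uv; exists x.
exists q; split=> //; split; first exact: submod_incl_inj.
  move=> y; have /uv[x xy] : v (val y) = 0 by exact: kernel_val.
  by exists x; apply: val_inj; rewrite qE.
move=> x; split=> [qx|].
  by apply/submod_inclP/submP; rewrite -qE qx linear0.
by move=> /submod_inclP/kernel_subP ux; apply: val_inj; rewrite qE ux linear0.
Qed.

Section Resolution.
Variables (M : lmodType A) (P : proj_resolution M).

(** [syzygy i] is the image of [P i.+1] in [P i], presented as a kernel. *)
Definition syzygy (i : nat) : lmodType A :=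
  match i with
  | 0 => submod (kernel_sub (res_aug P))
  | i'.+1 => submod (kernel_sub (res_diff P i'))
  end.

Definition syzygy_incl (i : nat) : {linear syzygy i -> P i} :=
  match i with
  | 0 => submod_incl (kernel_sub (res_aug P))
  | i'.+1 => submod_incl (kernel_sub (res_diff P i'))
  end.

Lemma syzygy_aug : ses (syzygy_incl 0) (res_aug P).
Proof. exact/ses_kernel/res_aug_surj. Qed.

Lemma syzygy_cover i : exists q : {linear P i.+1 -> syzygy i},
  ses (syzygy_incl i.+1) q /\ forall x, syzygy_incl i (q x) = res_diff P i x.
Proof.
case: i => [|i].
  by have [q [qE sq]] := exact_syzygy (@res_exact0 _ _ P); exists q.
by have [q [qE sq]] := exact_syzygy (@res_exactS _ _ P i); exists q.
Qed.

Lemma Ext_resolution d N k : (forall i, (d < i)%N -> forall x : P i, x = 0) ->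
  (d < k)%N -> Ext_vanishes k M N.
Proof.
move=> P0; case: k => // k dk.
have syz j i k' : (d <= i + j)%N -> (j <= k')%N -> Ext_vanishes k' (syzygy i) N.
  elim: j i k' => [|j IH] i k' dij jk; have [q [sq _]] := syzygy_cover i.
    apply: Ext_zero => x; case: sq => _ /(_ x)[y <-] _.
    by rewrite (P0 _ _ y) ?linear0 // ltnS -(addn0 i).
  case: k' jk => // k' jk; apply: (Ext_right sq).
    by apply: IH; rewrite // addSnnS.
  exact/Ext_projective/res_proj.
apply: (Ext_right syzygy_aug); first by apply: (syz d); rewrite ?add0n.
exact/Ext_projective/res_proj.
Qed.

(** A cocycle of degree [k.+1] is a map out of the [k]-th syzygy, and it is a
    coboundary when this map extends to [P k]. *)
Lemma Ext_vanishes_coboundary k N (f : {linear P k.+1 -> N}) :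
  Ext_vanishes k.+1 M N -> cocycle f -> coboundary f.
Proof.
move=> Mk fc.
have {Mk} [C [p [sp Z1]]] : exists C (p : {linear P k -> C}),
    ses (syzygy_incl k) p /\ Ext_vanishes 1 C N.
  elim: k {f fc} Mk => [|k IH] Mk.
    by exists M, (res_aug P); split=> //; exact: syzygy_aug.
  have [q [sq _]] := syzygy_cover k; exists (syzygy k), q; split=> //.
  have: Ext_vanishes k.+1 (syzygy 0) N by apply: Mk syzygy_aug; apply: res_proj.
  have: forall j i, Ext_vanishes j.+1 (syzygy i) N -> Ext_vanishes 1 (syzygy (i + j)) N.
    elim=> [|j IHj] i Zi; first by rewrite addn0.
    have [r [sr _]] := syzygy_cover i; rewrite -addSnnS; apply: IHj.
    by apply: Zi sr; apply: res_proj.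
  by move=> /(_ k 0%N) /[apply].
have [q [sq qE]] := syzygy_cover k.
have [|y qy|h hE] := @factor_surj _ _ _ _ q f; first by case: sq.
  have /res_exactS[x <-] : res_diff P k y = 0 by rewrite -qE qy linear0.
  exact: fc.
have [g gE] := Z1 _ _ _ _ sp h; exists g => x.
by rewrite -qE gE hE.
Qed.

End Resolution.

Lemma Ext_projdim M d N k : projdim_le M d -> (d < k)%N -> Ext_vanishes k M N.
Proof. by move=> [P P0]; apply: Ext_resolution P0. Qed.

Lemma Ext_vanishes_eq0 k M N : (0 < k)%N -> Ext_vanishes k M N -> Ext_eq0 k M N.
Proof. by case: k => // k _ Mk P f; apply: Ext_vanishes_coboundary. Qed.

End ExtVanishing.

(** * Noetherian modules *)

Section Noetherian.
Variable A : pzRingType.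
Implicit Types M N E : lmodType A.

Lemma image_of_closed M N (g : {linear M -> N}) (L : submodClosed M) :
  submP_closed (fun y => exists2 x, x \in L & g x = y).
Proof.
split=> [|a _ _ [x Lx <-] [y Ly <-]]; first by exists 0; rewrite ?rpred0 ?linear0.
by exists (a *: x + y); rewrite ?linearP // rpredD ?rpredZ.
Qed.

Definition image_of M N (g : {linear M -> N}) L := subm (image_of_closed g L).

(** Ascending chains stop, so maximal elements exist by dependent choice. *)
Lemma noetherian_max M (X : submodClosed M -> Prop) : noetherian_mod M ->
  (exists L, X L) ->
  exists2 L, X L & forall L', X L' -> {subset L <= L'} -> {subset L' <= L}.
Proof.
move=> Mn [L0 XL0]; apply: contrapT => nomax.
have step (L : {L | X L}) :
    exists L' : {L | X L}, {subset sval L <= sval L'} /\ ~ {subset sval L' <= sval L}.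
  case: L => L XL /=; apply: contrapT => nobig; apply: nomax; exists L => // L' XL' LL'.
  by apply: contrapT => L'L; apply: nobig; exists (exist _ L' XL').
have [next nextP] := choice step.
pose c i := sval (iter i next (exist _ L0 XL0)).
have [|m mE] := Mn c; first by move=> i; have [] := nextP (iter i next (exist _ L0 XL0)).
have [_] := nextP (iter m next (exist _ L0 XL0)); apply => x.
by have := mE m.+1 (leqnSn m) x; rewrite /c /= => ->.
Qed.

Lemma chain_le M (L : nat -> submodClosed M) :
  (forall i, {subset L i <= L i.+1}) -> forall i j, (i <= j)%N -> {subset L i <= L j}.
Proof.
move=> Lc i j /subnKC <-; elim: (j - i)%N => [|k IH] x Lx; first by rewrite addn0.
by rewrite addnS; apply/Lc/IH.
Qed.

Lemma noetherian_inj M N (i : {linear M -> N}) :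
  injective i -> noetherian_mod N -> noetherian_mod M.
Proof.
move=> ii Nn L Lc; have [|m mE] := Nn (fun k => image_of i (L k)).
  by move=> k _ /submP[x Lx <-]; apply/submP; exists x => //; apply: Lc.
exists m => k mk x; apply/idP/idP => [Lx|]; last exact: (chain_le Lc).
have : i x \in image_of i (L m) by rewrite -(mE k mk); apply/submP; exists x.
by case/submP => y Ly /ii <-.
Qed.

Lemma noetherian_surj M N (p : {linear M -> N}) :
  (forall y, exists x, p x = y) -> noetherian_mod M -> noetherian_mod N.
Proof.
move=> ps Mn L Lc; have [|m mE] := Mn (fun k => preimage_sub p (L k)).
  by move=> k x /preimage_subP Lx; apply/preimage_subP/Lc.
exists m => k mk y; have [x <-] := ps y.
apply/idP/idP => [Lx|]; last exact: (chain_le Lc).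
have : x \in preimage_sub p (L m) by rewrite -(mE k mk); apply/submP.
by move/submP.
Qed.

Lemma noetherian_ses M E N (i : {linear M -> E}) (p : {linear E -> N}) :
  ses i p -> noetherian_mod M -> noetherian_mod N -> noetherian_mod E.
Proof.
move=> [ii ps pE] Mn Nn L Lc.
have [|a aE] := Mn (fun k => preimage_sub i (L k)).
  by move=> k x /preimage_subP Lx; apply/preimage_subP/Lc.
have [|b bE] := Nn (fun k => image_of p (L k)).
  by move=> k _ /submP[x Lx <-]; apply/submP; exists x => //; apply: Lc.
pose m := maxn a b; exists m => k mk x; apply/idP/idP => [Lx|]; last exact: (chain_le Lc).
have am : (a <= m)%N by rewrite leq_maxl.
have bm : (b <= m)%N by rewrite leq_maxr.
have : p x \in image_of p (L m).
  rewrite (bE m bm) -(bE k (leq_trans bm mk)); apply/submP; by exists x.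
case/submP => y Ly pyx.
have /pE[z iz] : p (x - y) = 0 by rewrite linearB pyx subrr.
have : z \in preimage_sub i (L m).
  rewrite (aE m am) -(aE k (leq_trans am mk)); apply/submP; rewrite iz submB //.
  exact: chain_le mk _ Ly.
by move=> /submP; rewrite iz => Lxy; rewrite -(subrK y x) rpredD.
Qed.

Lemma noetherian_prod M N :
  noetherian_mod M -> noetherian_mod N -> noetherian_mod (M * N)%type.
Proof. exact: noetherian_ses (ses_prod M N). Qed.

Lemma noetherian_zero M : (forall x : M, x = 0) -> noetherian_mod M.
Proof. by move=> M0 L _; exists 0%N => i _ x; rewrite (M0 x) !rpred0. Qed.

Lemma noetherian_submod M (N : submodClosed M) :
  noetherian_mod M -> noetherian_mod (submod N).
Proof. by apply: noetherian_inj; apply: submod_incl_inj. Qed.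

Lemma noetherian_quotmod M (N : submodClosed M) :
  noetherian_mod M -> noetherian_mod (quotmod N).
Proof. by apply: noetherian_surj; apply: quotmod_pi_surj. Qed.

End Noetherian.

(** * Right modules and corner rings *)

Definition ract (R : pzRingType) (M : rmodType R) (v : M) (a : R) : M :=
  (a : R^c) *: v.
Notation "v *> a" := (ract v a) (at level 40, left associativity).

Section RightAction.
Variable R : pzRingType.
Implicit Types M N : rmodType R.

Lemma ractM M (v : M) a b : v *> a *> b = v *> (a * b).
Proof. exact: scalerA. Qed.
Lemma ract1 M (v : M) : v *> 1 = v.
Proof. exact: scale1r. Qed.
Lemma ract0 M (v : M) : v *> 0 = 0.
Proof. exact: scale0r. Qed.
Lemma ract0l M a : (0 : M) *> a = 0.
Proof. exact: scaler0. Qed.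
Lemma ractDr M (v : M) a b : v *> (a + b) = v *> a + v *> b.
Proof. exact: scalerDl. Qed.
Lemma ractBr M (v : M) a b : v *> (a - b) = v *> a - v *> b.
Proof. exact: scalerBl. Qed.
Lemma ractDl M (v w : M) a : (v + w) *> a = v *> a + w *> a.
Proof. exact: scalerDr. Qed.
Lemma ractBl M (v w : M) a : (v - w) *> a = v *> a - w *> a.
Proof. exact: scalerBr. Qed.
Lemma ract_lin M N (g : {linear M -> N}) v a : g (v *> a) = g v *> a.
Proof. exact: linearZ. Qed.
Lemma ract_sub M (L : submodClosed M) v a : v \in L -> v *> a \in L.
Proof. exact: rpredZ. Qed.
Lemma ract_val M (L : submodClosed M) (v : submod L) a : val (v *> a) = val v *> a.
Proof. exact: (ract_lin (submod_incl L)). Qed.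

End RightAction.

Section CornerModules.
Variables (R : pzRingType) (f : idempotent_of R).
Implicit Types M N E Q Z : rmodType R.

(** The restriction [M f] of a right module to the corner [fRf], as the set of
    elements fixed by [f]. *)
Section CornerModule.
Variable M : rmodType R.

Definition cmod_pred : pred M := fun x => x *> f == x.

Lemma cmod_zmod_closed : zmod_closed cmod_pred.
Proof.
split=> [|x y /eqP fx /eqP fy]; apply/eqP; first exact: ract0l.
by rewrite ractBl fx fy.
Qed.

Record cmod := Cmod { cmod_val :> M; cmod_valP : cmod_val \in cmod_pred }.
HB.instance Definition _ := [isSub for cmod_val].
HB.instance Definition _ := [Choice of cmod by <:].
HB.instance Definition _ := GRing.SubChoice_isSubZmodule.Build
  M cmod_pred cmod cmod_zmod_closed.

Lemma cmod_actP (x : cmod) : (x : M) *> f = x.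
Proof. exact/eqP/(cmod_valP x). Qed.

Lemma cmod_scale_subproof (a : corner f) (x : cmod) : (x : M) *> (a : R) \in cmod_pred.
Proof. by apply/eqP; rewrite ractM corner_mulr1 // (corner_valP a). Qed.

Definition cmod_scale (a : (corner f)^c) (x : cmod) : cmod :=
  Cmod (cmod_scale_subproof a x).

Lemma cmod_scaleA a b x : cmod_scale a (cmod_scale b x) = cmod_scale (a * b) x.
Proof. by apply: val_inj; rewrite /= ractM. Qed.
Lemma cmod_scale1 : left_id 1 cmod_scale.
Proof. by move=> x; apply: val_inj; rewrite /= cmod_actP. Qed.
Lemma cmod_scaleDr : right_distributive cmod_scale +%R.
Proof. by move=> a x y; apply: val_inj; rewrite /= ractDl. Qed.
Lemma cmod_scaleDl x : {morph cmod_scale^~ x : a b / a + b}.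
Proof. by move=> a b; apply: val_inj; rewrite /= ractDr. Qed.

HB.instance Definition _ := GRing.Zmodule_isLmodule.Build (corner f)^c cmod
  cmod_scaleA cmod_scale1 cmod_scaleDr cmod_scaleDl.

Lemma cmod_ract (x : cmod) (a : corner f) : val (x *> a) = val x *> (a : R).
Proof. by []. Qed.

Lemma cmod_mem (x : M) : x *> f \in cmod_pred.
Proof. by apply/eqP; rewrite ractM idemP. Qed.

Definition cmod_proj (x : M) : cmod := Cmod (cmod_mem x).

End CornerModule.

Lemma cmod_map_subproof M N (g : {linear M -> N}) (x : cmod M) : g (val x) \in @cmod_pred N.
Proof. by apply/eqP; rewrite -ract_lin cmod_actP. Qed.

Definition cmod_map_fun M N (g : {linear M -> N}) (x : cmod M) : cmod N :=
  Cmod (cmod_map_subproof g x).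

Lemma cmod_map_linear M N (g : {linear M -> N}) : linear (cmod_map_fun g).
Proof.
move=> a x y; apply: val_inj; rewrite /= linearD; congr (_ + _).
exact: (ract_lin g (val x) (a : corner f)).
Qed.

Definition cmod_map M N (g : {linear M -> N}) : {linear cmod M -> cmod N} :=
  linear_of (cmod_map_linear g).

Lemma cmod_map_val M N (g : {linear M -> N}) (x : cmod M) : val (cmod_map g x) = g (val x).
Proof. by []. Qed.

Lemma cmod_map_surj M N (g : {linear M -> N}) :
  (forall y, y *> f = y -> exists x, g x = y) -> forall y, exists x, cmod_map g x = y.
Proof.
move=> gs y; have [x xy] := gs (val y) (cmod_actP y).
by exists (cmod_proj x); apply: val_inj; rewrite /= ract_lin xy cmod_actP.
Qed.

Lemma cmod_ses M E N (i : {linear M -> E}) (p : {linear E -> N}) :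
  injective i -> (forall x, p x = 0 <-> exists z, i z = x) ->
  (forall y, y *> f = y -> exists x, p x = y) -> ses (cmod_map i) (cmod_map p).
Proof.
move=> ii pE ps; split; last 2 first.
- exact: cmod_map_surj.
- move=> x; split=> [/(congr1 val)/pE[z iz]|[z <-]].
    exists (cmod_proj z); apply: val_inj.
    by rewrite /= ract_lin iz cmod_actP.
  by apply: val_inj; apply/pE; exists (val z).
- by move=> x y /(congr1 val)/ii/val_inj.
Qed.

End CornerModules.

(** * Resolutions relative to an idempotent *)

Section RelativeResolutions.
Variables (R : pzRingType) (f : idempotent_of R).
Implicit Types M N Q Z : rmodType R.

Definition torsion M := forall x : M, x *> f = 0.

Definition torsion_orthogonal Q :=
  forall N (G : {linear Q -> N}), torsion N -> forall x, G x = 0.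

(** The noetherian modules induced from projective modules over [fRf]: the last
    two clauses say that maps out of [Q] are the same as maps out of its
    restriction, which is the universal property of induction. *)
Definition corner_projective Q :=
  [/\ noetherian_mod Q, projective_mod (cmod f Q),
      forall N (g : {linear cmod f Q -> cmod f N}),
        exists G : {linear Q -> N}, forall x : cmod f Q, G (val x) = val (g x)
    & forall N (G : {linear Q -> N}),
        (forall x : cmod f Q, G (val x) = 0) -> forall x, G x = 0].

Lemma corner_projective_eq Q N (G H : {linear Q -> N}) : corner_projective Q ->
  (forall x : cmod f Q, G (val x) = H (val x)) -> G =1 H.
Proof.
move=> [_ _ _ uQ] GH x; apply/subr0_eq/(uQ N (G \- H)) => y.
by rewrite /= GH subrr.
Qed.

Lemma corner_projective_projective Q : corner_projective Q -> projective_mod Q.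
Proof.
move=> cQ M N p g ps; have [_ pQ eQ _] := cQ.
have [|h hE] := pQ _ _ (cmod_map f p) (cmod_map f g).
  by apply: cmod_map_surj => y _; apply: ps.
have [H HE] := eQ _ h; exists H; apply: (corner_projective_eq (G := p \o H) cQ) => x.
by rewrite /= HE -(cmod_map_val p) hE.
Qed.

Lemma corner_projective_orthogonal Q : corner_projective Q -> torsion_orthogonal Q.
Proof.
move=> [_ _ _ uQ] N G tN; apply: uQ => x.
have <- : val x *> f = val x by exact: cmod_actP.
by rewrite ract_lin tN.
Qed.

Lemma corner_projective_zero Q : (forall x : Q, x = 0) -> corner_projective Q.
Proof.
move=> Q0; split; first exact: noetherian_zero.
- by apply: projective_zero => x; apply: val_inj; rewrite (Q0 (val x)) [RHS]Q0.
- move=> N g; exists \0 => x; have -> : x = 0 by apply/val_inj; rewrite (Q0 (val x)) [RHS]Q0.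
  by rewrite (linear0 g); reflexivity.
- by move=> N G _ x; rewrite (Q0 x) linear0.
Qed.

Lemma corner_projective_prod P Q :
  corner_projective P -> corner_projective Q -> corner_projective (P * Q)%type.
Proof.
move=> [nP pP eP uP] [nQ pQ eQ uQ].
pose il := cmod_map f (@pair_inl _ P Q); pose ir := cmod_map f (@pair_inr _ P Q).
pose pl := cmod_map f (fst : {linear (P * Q)%type -> P}).
pose pr := cmod_map f (snd : {linear (P * Q)%type -> Q}).
have split_pair x : x = il (pl x) + ir (pr x).
  apply: val_inj; rewrite /=; case: (cmod_val x) => a b.
  by congr pair; rewrite /= ?addr0 ?add0r.
split; first exact: noetherian_prod.
- apply: (projective_retract (i := (@pair_inl _ _ _ \o pl) \+ (@pair_inr _ _ _ \o pr))
    (r := (il \o fst) \+ (ir \o snd)) _ (projective_prod pP pQ)) => x.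
  rewrite [RHS]split_pair; congr (il _ + ir _); first exact: addr0.
  exact: add0r.
- move=> N g; have [G GE] := eP _ (g \o il); have [H HE] := eQ _ (g \o ir).
  exists ((G \o fst) \+ (H \o snd)) => x.
  transitivity (G (val (pl x)) + H (val (pr x))); first by [].
  by rewrite GE HE [in RHS](split_pair x) linearD.
- move=> N G G0 -[a b].
  have -> : (a, b) = @pair_inl _ P Q a + @pair_inr _ P Q b.
    by congr pair; rewrite /= ?addr0 ?add0r.
  have Gl : G (@pair_inl _ P Q a) = 0.
    by apply: (uP N (G \o @pair_inl _ P Q)) => x; apply: (G0 (il x)).
  have Gr : G (@pair_inr _ P Q b) = 0.
    by apply: (uQ N (G \o @pair_inr _ P Q)) => x; apply: (G0 (ir x)).
  by rewrite linearD Gl Gr addr0.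
Qed.

Lemma principal_unit_subproof : (f : R) \in principal_submod f.
Proof. by apply/eqP; rewrite idemP. Qed.

Definition principal_unit : principal f := Submod principal_unit_subproof.

Lemma principal_gen (x : principal f) : principal_unit *> (val x : R) = x.
Proof. by apply: val_inj; rewrite ract_val; apply/eqP/(submod_valP x). Qed.

Lemma principal_map_linear M (m : M) : linear (fun x : principal f => m *> (val x : R)).
Proof.
move=> a x y; rewrite -[a *: x]/(x *> a) [val _](linearD (submod_incl _)).
by rewrite [X in _ *> (X + _)](ract_lin (submod_incl _)) ractDr -ractM.
Qed.

Definition principal_map M (m : M) : {linear principal f -> M} :=
  linear_of (principal_map_linear m).

Lemma principal_corner_subproof (x : cmod f (principal f)) :
  (val (val x) : R) \in corner_pred f.
Proof.
apply/eqP; have /eqP -> : (f : R) * (val (val x) : R) == val (val x) := submod_valP (val x).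
by have := congr1 val (cmod_actP x); rewrite ract_val.
Qed.

Definition principal_corner (x : cmod f (principal f)) : corner f :=
  Corner (principal_corner_subproof x).

Lemma cmod_valD M (x y : cmod f M) : val (x + y) = val x + val y.
Proof. by []. Qed.

Lemma principal_corner_linear (a : corner f) (x y : cmod f (principal f)) :
  principal_corner (x *> a + y) = principal_corner x * a + principal_corner y.
Proof.
have cE z : val (principal_corner z) = (val (val z) : R) by [].
have cM (u v : corner f) : val (u * v) = val u * val v by [].
apply: val_inj; rewrite [RHS]raddfD [X in _ = X + _]cM !cE cmod_valD cmod_ract.
rewrite [LHS](linearD (submod_incl _)).
by rewrite [X in X + _ = _](ract_lin (submod_incl _)).
Qed.

(** [fR] corresponds to the regular module of [fRf]: maps out of either are
    given by the image of [f]. *)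
Lemma corner_projective_principal : right_noetherian R -> corner_projective (principal f).
Proof.
move=> nR.
have u0P : principal_unit \in @cmod_pred R f (principal f).
  by apply/eqP/val_inj; rewrite ract_val; exact (idemP f).
pose u0 : cmod f (principal f) := Cmod u0P.
have u0c x : u0 *> principal_corner x = x.
  by apply: val_inj; rewrite cmod_ract; apply: principal_gen.
split.
- exact: noetherian_submod.
- move=> M N p g ps; have [m mE] := ps (g u0).
  have hl : linear (fun x => m *> principal_corner x).
    by move=> a x y; rewrite -[a *: x]/(x *> a) principal_corner_linear ractDr -ractM.
  exists (linear_of hl) => x.
  by rewrite -[RHS](congr1 g (u0c x)) /= !ract_lin mE.
- move=> N g; exists (principal_map (val (g u0))) => x.
  by rewrite -[in RHS](u0c x) ract_lin cmod_ract.
- move=> N G G0 x; rewrite -(principal_gen x) ract_lin.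
  by rewrite (G0 u0) ract0l.
Qed.

(** The image of a cover by copies of [fR] can be enlarged by one more copy as
    long as it misses an element of [M f]. *)

Lemma corner_projective_cover M : right_noetherian R -> noetherian_mod M ->
  exists Q (q : {linear Q -> M}), corner_projective Q /\
    forall y, y *> f = y -> exists x, q x = y.
Proof.
move=> nR nM.
pose X (L : submodClosed M) := exists Q (q : {linear Q -> M}), corner_projective Q /\
  forall y, y \in L <-> exists x, q x = y.
have [|L [Q [q [cQ LE]]] Lmax] := @noetherian_max _ M X nM.
  pose z := zero_sub M.
  have z0 (x : submod z) : x = 0 by exact: zero_val.
  exists z, (submod z), (submod_incl z); split; first exact: corner_projective_zero.
  by move=> y; split=> /submod_inclP.
exists Q, q; split=> // y yf; apply/LE.
pose q' : {linear (Q * principal f)%type -> M} := (q \o fst) \+ (principal_map y \o snd).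
have q'E a b : q' (a, b) = q a + y *> (val b : R) by [].
apply: (Lmax (image_sub q')).
- exists (Q * principal f)%type, q'; split.
    exact: corner_projective_prod (corner_projective_principal nR).
  by move=> z; split=> /image_subP.
- move=> _ /LE[a <-]; apply/image_subP; exists (a, 0).
  by rewrite q'E [val 0](linear0 (submod_incl _)) ract0 addr0.
- by apply/image_subP; exists (0, principal_unit); rewrite q'E linear0 add0r yf.
Qed.

(** A finite complex of projectives ending in [M]; at each stage [Q -> M] covers
    the part of [M] generated by [f], so that its cokernel is torsion, and [Z] is
    its kernel. *)
Inductive relative_resolution : nat -> rmodType R -> Prop :=
| RelResZero M : (forall x : M, x = 0) -> relative_resolution 0 M
| RelResStep n M Q Z (q : {linear Q -> M}) (i : {linear Z -> Q}) :
    noetherian_mod M -> projective_mod Q -> torsion_orthogonal Q ->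
    injective i -> (forall x, q x = 0 <-> exists z, i z = x) ->
    (forall y, y *> f = y -> exists x, q x = y) ->
    relative_resolution n Z -> relative_resolution n.+1 M.

Lemma relative_resolution_torsion M :
  noetherian_mod M -> torsion M -> relative_resolution 1 M.
Proof.
move=> nM tM; pose z := zero_sub M.
have z0 (x : submod z) : x = 0 by exact: zero_val.
apply: (@RelResStep 0 M (submod z) (submod z) \0 idfun) => //.
- exact: projective_zero.
- by move=> N G _ x; rewrite (z0 x) linear0.
- by move=> x; split=> // _; exists x.
- by move=> y <-; exists 0; rewrite tM.
- exact: RelResZero.
Qed.

(** A splitting of [Qf -> Mf] extends to an idempotent endomorphism of [Q],
    whose image covers [Mf] with a torsion kernel. *)
Lemma relative_resolution_projective M : right_noetherian R -> noetherian_mod M ->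
  projective_mod (cmod f M) -> relative_resolution 2 M.
Proof.
move=> nR nM pM; have [Q [q [cQ qs]]] := corner_projective_cover nR nM.
have [s sE] := projective_split pM (cmod_map_surj qs).
have [nQ _ eQ _] := cQ.
have [T TE] := eQ _ (s \o cmod_map f q).
have qT : q \o T =1 q.
  apply: (corner_projective_eq cQ) => x.
  exact (etrans (congr1 (fun z => q z) (TE x)) (congr1 val (sE (cmod_map f q x)))).
have TT : T \o T =1 T.
  apply: (corner_projective_eq cQ) => x.
  apply: (etrans (congr1 (fun z => T z) (TE x))); rewrite !TE.
  exact (congr1 (fun y : cmod f M => val (s y)) (sE (cmod_map f q x))).
pose F := kernel_sub (T \- idfun).
have FP x : reflect (T x = x) (x \in F).
  apply: (iffP (@kernel_subP _ _ _ _ _)) => [/subr0_eq //|E].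
  by rewrite /= E subrr.
have [|t tE] := @corestrict _ _ _ T F; first by move=> x; apply/FP/TT.
have tF (x : submod F) : t (submod_incl F x) = x.
  by apply: val_inj; rewrite tE; apply/FP/submod_mem.
pose q' : {linear submod F -> M} := q \o submod_incl F.
have [iinj _ iE] : ses (submod_incl (kernel_sub q')) (quotmod_pi (kernel_sub q')).
  exact: ses_quot.
apply: (@RelResStep 1 M (submod F) (submod (kernel_sub q')) q' (submod_incl _)) => //.
- exact: projective_retract tF (corner_projective_projective cQ).
- move=> N G tN x; rewrite -(tF x).
  exact (corner_projective_orthogonal cQ (G \o t) tN (submod_incl F x)).
- move=> x; rewrite -iE quotmod_pi_eq0.
  by split=> [?|/kernel_subP]; first apply/kernel_subP.
- move=> y yf; have [x <-] := qs y yf; exists (t x).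
  by rewrite /= /submod_incl tE; apply: qT.
apply: relative_resolution_torsion; first exact/noetherian_submod/noetherian_submod.
move=> z; apply: val_inj; apply: val_inj; rewrite !ract_val.
pose x : cmod f Q := cmod_proj f (val (val z)).
have Tx : T (val x) = val x.
  by rewrite ract_lin; congr (_ *> f); apply/FP/submod_mem.
have qx : q (val x) = 0 by rewrite ract_lin [q _](@kernel_val _ _ _ q' z) ract0l.
have qx0 : cmod_map f q x = 0 by apply: val_inj.
transitivity (T (val x)); first by rewrite Tx.
rewrite TE; apply: (etrans (congr1 (fun y : cmod f M => val (s y)) qx0)).
by rewrite linear0.
Qed.

(** After [d] covers the kernel restricts to a projective module over the corner;
    one more step leaves a torsion kernel, which is all homology. *)
Lemma relative_resolution_exists d M : right_noetherian R -> noetherian_mod M ->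
  (forall (N : rmodType (corner f)) k, (d < k)%N -> Ext_vanishes k (cmod f M) N) ->
  relative_resolution d.+2 M.
Proof.
move=> nR; elim: d M => [|d IH] M nM dM.
  apply: relative_resolution_projective => //; apply: Ext1_all_projective => N.
  exact: dM.
have [Q [q [cQ qs]]] := corner_projective_cover nR nM.
have [nQ pQ _ _] := cQ.
have [iinj _ iE] := ses_quot (kernel_sub q).
have kE x : q x = 0 <-> exists z, submod_incl (kernel_sub q) z = x.
  by rewrite -iE quotmod_pi_eq0; split=> [?|/kernel_subP]; first apply/kernel_subP.
apply: (RelResStep nM (corner_projective_projective cQ)
  (corner_projective_orthogonal cQ) iinj kE qs).
apply: IH => [|N [//|k] dk]; first exact: noetherian_submod.
apply: (Ext_left (cmod_ses iinj kE qs)); first exact: Ext_projective.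
exact: dM.
Qed.

End RelativeResolutions.

(** * Cycles of extensions between simple modules *)

(** The modules of a chordless cycle [s]: in positive degrees, Ext from [S l] is
    nonzero into [S (s l)] only, and for the last time in degree [p l]. *)
Section Cycle.
Variables (R : pzRingType) (f : idempotent_of R) (L : Type) (eps : L -> R).
Variables (S : L -> rmodType R) (s : L -> L) (p : L -> nat) (P : nat).
Implicit Types M N Q Z H : rmodType R.

(** For a torsion module: [S l] does not occur as a factor of [H]. *)
Definition killed l H := forall x : H, x *> eps l = 0.

(** A substitute for composition series: by noetherian induction, statements about
    torsion modules reduce to the [S l]. *)
Definition has_simple_layers := forall H (W : submodClosed H),
  torsion f H -> (exists x, x \notin W) ->
  exists (W' : submodClosed H) (l : L) (g : {linear submod W' -> S l}),
    [/\ {subset W <= W'}, forall y, exists x, g x = y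
      & forall x, g x = 0 <-> val x \in W].

Hypothesis eps_idem : forall l, eps l * eps l = eps l.
Hypothesis S_nz : forall l, exists x : S l, x <> 0.
Hypothesis S_id : forall l (x : S l), x *> eps l = x.
Hypothesis S_off : forall l l', l <> l' -> killed l' (S l).
Hypothesis layers : has_simple_layers.
Hypothesis p_pos : forall l, (0 < p l)%N.
Hypothesis p_bound : forall l, (p l <= P)%N.
Hypothesis Ext_above : forall l m k, (p l < k)%N -> Ext_vanishes k (S l) (S m).
Hypothesis Ext_off : forall l l' k, l <> l' -> (0 < k)%N ->
  Ext_vanishes k (S l) (S (s l')).
Hypothesis Ext_top : forall l, ~ Ext_vanishes (p l) (S l) (S (s l)).

Lemma layer_ses H (W W' : submodClosed H) N (g : {linear submod W' -> N}) :
  {subset W <= W'} -> (forall y, exists x, g x = y) ->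
  (forall x, g x = 0 <-> val x \in W) ->
  exists i : {linear submod W -> submod W'}, ses i g.
Proof.
move=> WW' gs gE; have [|i iE] := @corestrict _ _ _ (submod_incl W) W'.
  by move=> x; apply/WW'/submod_mem.
exists i; split=> //.
  by move=> x y /(congr1 val); rewrite !iE => /val_inj.
move=> x; rewrite gE; split=> [/submod_inclP[y yx]|[y <-]].
  by exists y; apply: val_inj; rewrite iE.
by rewrite iE; apply: submod_mem.
Qed.

Lemma killed_quotmod l H (W : submodClosed H) : killed l H -> killed l (quotmod W).
Proof.
by move=> kH y; have [x <-] := quotmod_pi_surj y; rewrite -ract_lin kH linear0.
Qed.

Lemma killed_submod l H (W : submodClosed H) : killed l H -> killed l (submod W).
Proof. by move=> kH y; apply: val_inj; rewrite ract_val kH. Qed.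

Lemma killed_surj l H N (g : {linear H -> N}) :
  (forall y, exists x, g x = y) -> killed l H -> killed l N.
Proof. by move=> gs kH y; have [x <-] := gs y; rewrite -ract_lin kH linear0. Qed.

Lemma killed_Hom l H : killed l H -> Ext_vanishes 0 H (S l).
Proof. by move=> kH g x; rewrite -(S_id (g x)) -ract_lin kH linear0. Qed.

Lemma killed_simple l : ~ killed l (S l).
Proof. by move=> kS; have [x] := S_nz l; apply; rewrite -(S_id x) kS. Qed.

Lemma torsion_submod H (W : submodClosed H) : torsion f H -> torsion f (submod W).
Proof. by move=> tH x; apply: val_inj; rewrite ract_val tH. Qed.

Lemma torsion_quotmod H (W : submodClosed H) : torsion f H -> torsion f (quotmod W).
Proof.
by move=> tH y; have [x <-] := quotmod_pi_surj y; rewrite -ract_lin tH linear0.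
Qed.

(** A submodule that is maximal among those with vanishing Ext is everything,
    since it could otherwise be enlarged by a simple layer. *)
Lemma Ext_layers H N k : noetherian_mod H -> torsion f H ->
  (forall l, killed l H \/ Ext_vanishes k (S l) N) -> Ext_vanishes k H N.
Proof.
move=> nH tH Hl.
have [|W XW Wmax] :=
  @noetherian_max _ H (fun W => Ext_vanishes k (submod W) N) nH.
  by exists (zero_sub H); apply: Ext_zero; apply: zero_val.
have [WT|] := pselect (forall x, x \in W).
  apply: (Ext_mid (ses_quot W)) => //; apply: Ext_zero => y.
  by have [x <-] := quotmod_pi_surj y; apply/quotmod_pi_eq0.
move=> /existsNP[x /negP xW]; have [|W' [l [g [WW' gs gE]]]] := layers tH (W := W).
  by exists x.
have nkl : ~ killed l H.
  by move/(killed_submod (W := W'))/(killed_surj gs)/killed_simple.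
have [//|Sl] := Hl l; have [i sig] := layer_ses WW' gs gE.
have {Wmax} W'W := Wmax W' (Ext_mid sig XW Sl) WW'.
have [y y0] := S_nz l; have [z zy] := gs y; case: y0; rewrite -zy.
by apply/gE/W'W/submod_mem.
Qed.

(** Let [W] be the largest submodule without factors [S l] for [q <= p l].  If it
    is proper, a simple layer above it is some [S l] with [p l = q], and
    Ext^q(S_l, S_(s l)) is squeezed between Ext^(q-1) of [W] and Ext^q of [H].  The
    former vanishes: only [S l] and, in degree 0, [S (s l)] could contribute to it,
    and [W] has no such factor in the relevant case. *)
Lemma killed_step H q : noetherian_mod H -> torsion f H -> (0 < q)%N ->
  (forall l, (q < p l)%N -> killed l H) ->
  (forall l, p l = q -> Ext_vanishes q H (S (s l))) ->
  forall l, (q <= p l)%N -> killed l H.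
Proof.
move=> nH tH q0 kH EH.
have Wc : submP_closed (fun x : H => forall l r, (q <= p l)%N -> x *> r *> eps l = 0).
  split=> [l r _|a x y Wx Wy l r ql]; first by rewrite !ract0l.
  rewrite -[a *: x]/(x *> a) 2!ractDl Wy // addr0 (ractM x).
  exact: Wx.
pose W := subm Wc.
have Wk l : (q <= p l)%N -> killed l (submod W).
  move=> ql x; apply: val_inj; rewrite ract_val.
  by have /submP/(_ l 1 ql) := submod_mem x; rewrite ract1.
have [WT l ql x|] := pselect (forall x, x \in W).
  by have /submP/(_ l 1 ql) := WT x; rewrite ract1.
move=> /existsNP[x /negP xW]; have [|W' [l [g [WW' gs gE]]]] := layers tH (W := W).
  by exists x.
have [i sig] := layer_ses WW' gs gE.
have pq : p l = q.
  apply/eqP; rewrite eqn_leq; apply/andP; split; rewrite leqNgt; apply/negP => lq.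
    by have /(killed_submod (W := W'))/(killed_surj gs)/killed_simple := kH l lq.
  have W'W : {subset W' <= W}.
    move=> y Wy; apply/submP => l' r ql'.
    have ll' : l <> l' by move=> E; rewrite E ltnNge ql' in lq.
    have : val (Submod Wy *> r *> eps l') \in W.
      by apply/gE; rewrite 2!ract_lin S_off.
    by rewrite 2!ract_val => /submP/(_ l' 1 ql'); rewrite ract1 ractM eps_idem.
  have [y y0] := S_nz l; have [z zy] := gs y; case: y0; rewrite -zy.
  by apply/gE/W'W/submod_mem.
case: (Ext_top (l := l)); rewrite pq.
have EW' : Ext_vanishes q (submod W') (S (s l)).
  apply: (Ext_left (ses_quot W')); first exact: EH.
  apply: Ext_layers; [exact: noetherian_quotmod | exact: torsion_quotmod | move=> l'].
  have [lq|ql] := leqP (p l') q; first by right; apply: Ext_above.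
  by left; apply/killed_quotmod/kH.
rewrite -(prednK q0) in EW' *; apply: (Ext_right sig) EW'.
have [q1|q1] := ltnP 1 q.
  apply: Ext_layers; [exact: noetherian_submod | exact: torsion_submod | move=> l'].
  have [<-|ll'] := pselect (l = l'); first by left; apply: Wk; rewrite pq.
  by right; apply: Ext_off; [exact: nesym | rewrite -ltnS prednK].
have -> : q.-1 = 0%N by case: q q1 {q0 kH EH Wc W xW Wk W' g WW' gs gE i sig pq} => [|[]].
by apply: killed_Hom; apply: Wk; apply: leq_trans q1 (p_pos _).
Qed.

(** The exclusion of factors with [p l + t] large, expressed by Ext out of one
    module only: this form can be carried along a complex by induction, without
    mention of the homology of the later terms.  [Ext_gap1] is the version for the
    image of a term, whose Ext is that of the kernel shifted by one degree. *)
Definition Ext_gap2 M := forall c, (forall m k, (c < k)%N -> Ext_vanishes k M (S m)) ->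
  forall l, (c.+1 < p l)%N -> Ext_vanishes c M (S (s l)).

Definition Ext_gap1 M := forall c, (forall m k, (c < k)%N -> Ext_vanishes k M (S m)) ->
  forall l, (c < p l)%N -> Ext_vanishes c M (S (s l)).

Lemma Ext_sub_above M (B : submodClosed M) c : noetherian_mod M ->
  torsion f (quotmod B) -> (forall m k, (c < k)%N -> Ext_vanishes k M (S m)) ->
  (forall l, (c.+1 < p l)%N -> killed l (quotmod B)) ->
  forall m k, (c < k)%N -> Ext_vanishes k (submod B) (S m).
Proof.
move=> nM tH EM kH m k ck; apply: (Ext_left (ses_quot B)); first exact: EM.
apply: Ext_layers => //; first exact: noetherian_quotmod.
move=> l; have [cp|pc] := ltnP c.+1 (p l); first by left; apply: kH.
by right; apply: Ext_above; apply: leq_ltn_trans pc _; rewrite ltnS.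
Qed.

(** Descending induction on the bound, from [P] down to [c]: once the factors of
    [M / B] with [p l > d.+1] are excluded, the gap for [B] makes Ext^(d+1) of
    [M / B] into [S (s l)] vanish, and [killed_step] excludes [p l = d.+1]. *)
Lemma killed_above M (B : submodClosed M) c : noetherian_mod M ->
  torsion f (quotmod B) -> Ext_gap1 (submod B) ->
  (forall m k, (c < k)%N -> Ext_vanishes k M (S m)) ->
  forall l, (c < p l)%N -> killed l (quotmod B).
Proof.
move=> nM tH gB EM.
have: forall n d, (c <= d)%N -> (P <= d + n)%N ->
    forall l, (d < p l)%N -> killed l (quotmod B).
  elim=> [|n IH] d cd dP l dl.
    by have := leq_trans dl (leq_trans (p_bound l) dP); rewrite addn0 ltnn.
  have kH l' : (d.+1 < p l')%N -> killed l' (quotmod B).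
    by apply: IH; [exact: leqW | rewrite addSnnS].
  have EMd m k : (d < k)%N -> Ext_vanishes k M (S m).
    by move=> dk; apply: EM; apply: leq_ltn_trans dk.
  apply: (@killed_step _ d.+1) dl => //; first exact: noetherian_quotmod.
  move=> l' pl'; apply: (Ext_right (ses_quot B)); last exact: EMd.
  by apply: gB; [exact: Ext_sub_above | rewrite pl'].
by move=> /(_ P c (leqnn c)); apply; rewrite leq_addl.
Qed.

Lemma Ext_gap_quot M (B : submodClosed M) : noetherian_mod M ->
  torsion f (quotmod B) -> Ext_gap1 (submod B) -> Ext_gap2 M.
Proof.
move=> nM tH gB c EM l cl; have kH := killed_above nM tH gB EM.
apply: (Ext_mid (ses_quot B)).
  apply: gB; last exact: ltnW.
  by apply: Ext_sub_above => // l' /ltnW; apply: kH.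
case: c => [|c] in EM cl kH *; first by apply: killed_Hom; apply: kH.
apply: Ext_layers => //; first exact: noetherian_quotmod.
move=> l'; have [<-|ll'] := pselect (l = l'); first by left; apply/kH/ltnW.
by right; apply: Ext_off => //; apply: nesym.
Qed.

Lemma Ext_gap_image M Q Z (q : {linear Q -> M}) (i : {linear Z -> Q}) :
  projective_mod Q -> torsion_orthogonal f Q -> (forall l, torsion f (S l)) ->
  injective i -> (forall x, q x = 0 <-> exists z, i z = x) ->
  Ext_gap2 Z -> Ext_gap1 (submod (image_sub q)).
Proof.
move=> pQ oQ tS ii qE gZ.
have [|r rE] := @corestrict _ _ _ q (image_sub q).
  by move=> x; apply/image_subP; exists x.
have rs y : exists x, r x = y.
  have /image_subP[x xy] := submod_mem y.
  by exists x; apply: val_inj; rewrite rE.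
have sir : ses i r.
  split=> // x; rewrite -qE; split=> [rx|qx]; first by rewrite -rE rx.
  by apply: val_inj; rewrite rE.
case=> [|c] EB l cl.
  by apply: (Ext_surj0 rs) => g; apply: oQ.
apply: (Ext_right sir); last exact: Ext_projective.
apply: gZ => // m k ck; apply: (Ext_left sir); last exact: EB.
by case: k ck => // k _; apply: Ext_projective.
Qed.

Lemma torsion_cokernel M Q (q : {linear Q -> M}) :
  (forall y, y *> f = y -> exists x, q x = y) -> torsion f (quotmod (image_sub q)).
Proof.
move=> qs y; have [x <-] := quotmod_pi_surj y; rewrite -ract_lin.
apply/quotmod_pi_eq0/image_subP/qs.
by rewrite ractM idemP.
Qed.

Lemma relative_resolution_gap n M : (forall l, torsion f (S l)) ->
  relative_resolution f n M -> Ext_gap2 M.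
Proof.
move=> tS; elim=> {n M} [M M0 c _ l _|n M Q Z q i nM pQ oQ ii qE qs _ gZ].
  exact: Ext_zero.
apply: (Ext_gap_quot (B := image_sub q)) => //; first exact: torsion_cokernel.
exact: Ext_gap_image qE gZ.
Qed.

(** For [M] projective, [killed_above] with [c = 0] excludes every factor of the
    cokernel of [Q -> M]. *)
Lemma relative_resolution_Hom n M l : (forall l, torsion f (S l)) ->
  relative_resolution f n M -> projective_mod M ->
  forall (h : {linear M -> S l}) x, h x = 0.
Proof.
move=> tS; case=> {n M} [M M0 _ h x|n M Q Z q i nM pQ oQ ii qE qs rZ pM h x].
  by rewrite (M0 x) linear0.
have gB := Ext_gap_image pQ oQ tS ii qE (relative_resolution_gap tS rZ).
have tH := torsion_cokernel qs.
have kH l' : killed l' (quotmod (image_sub q)).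
  apply: (killed_above (c := 0) nM tH gB) => // m [//|k] _.
  exact: Ext_projective.
have H0 (y : quotmod (image_sub q)) : y = 0.
  apply: contrapT => y0.
  have [|W' [l' [g [_ gs _]]]] := layers tH (W := zero_sub _).
    by exists y; apply/negP => /zero_subP.
  exact/killed_simple/(killed_surj gs)/killed_submod/kH.
have /image_subP[z <-] : x \in image_sub q by apply/quotmod_pi_eq0.
exact: (oQ _ (h \o q)).
Qed.

End Cycle.

(** * Idempotents modulo the Jacobson radical *)

Section ModuloRadical.
Variable R : pzRingType.
Implicit Types (x y a b : R).

Local Notation B := (quotring (jacobson R)).

Definition modJ x : B := \pi_(quotring (jacobson R)) x.

Lemma modJM x y : modJ (x * y) = modJ x * modJ y.
Proof. exact: quotring_piM. Qed.
Lemma modJD x y : modJ (x + y) = modJ x + modJ y.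
Proof. exact: quotring_piD. Qed.
Lemma modJ1 : modJ 1 = 1.
Proof. by []. Qed.
Lemma modJ_eqP x y : modJ x = modJ y <-> x - y \in @jacobson_pred R.
Proof.
have <- : (modJ x == modJ y) = (x - y \in @jacobson_pred R) by exact: quotring_eqE.
by split=> [->|/eqP].
Qed.
Lemma modJ0 : modJ 0 = 0.
Proof. by apply: (addrI (modJ 0)); rewrite -modJD !addr0. Qed.
Lemma modJN x : modJ (- x) = - modJ x.
Proof. by apply/eqP; rewrite -subr_eq0 opprK -modJD addNr modJ0. Qed.
Lemma modJB x y : modJ (x - y) = modJ x - modJ y.
Proof. by rewrite modJD modJN. Qed.
Lemma modJ_eq0 x : modJ x = 0 <-> x \in @jacobson_pred R.
Proof. by rewrite -modJ0 modJ_eqP subr0. Qed.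
Lemma modJ_surj (y : B) : exists x, modJ x = y.
Proof. by exists (repr y); rewrite /modJ reprK. Qed.
Lemma modJ_sum (I : Type) (r : seq I) (Q : pred I) (F : I -> R) :
  modJ (\sum_(i <- r | Q i) F i) = \sum_(i <- r | Q i) modJ (F i).
Proof. exact: (big_morph modJ modJD modJ0). Qed.

Lemma right_regularE (x : right_regular R) a : x *> a = (x : R) * a.
Proof. by []. Qed.

Hypothesis nR : right_noetherian R.

(** The noetherian hypothesis replaces Zorn's lemma. *)
Lemma maximal_above (I : submodClosed (right_regular R)) : (1 : R) \notin I ->
  exists2 N, maximal_submod N & {subset I <= N}.
Proof.
move=> I1; have [|N [IN N1] Nmax] := @noetherian_max _ _
  (fun N : submodClosed (right_regular R) => {subset I <= N} /\ (1 : R) \notin N) nR.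
  by exists I; split.
exists N => //; split=> [/(_ 1)|K NK]; first by rewrite (negbTE N1) inE.
have [K1|K1] := boolP ((1 : R) \in K).
  right=> x; rewrite inE; apply/idP.
  have : ((1 : R) : right_regular R) *> (x : R) \in K by apply: ract_sub.
  by rewrite right_regularE mul1r.
left=> x; apply/idP/idP; last exact: NK.
by apply: Nmax => //; split=> // y /IN/NK.
Qed.

Lemma modJ1_unit x : modJ x = 1 -> exists2 v, x * v = 1 & v * x = 1.
Proof.
have rinv y : modJ y = 1 -> exists v, y * v = 1.
  move=> y1; apply: contrapT => nv.
  have yc : submP_closed (fun z : right_regular R => exists v, y * v = z).
    split=> [|a _ _ [v <-] [w <-]]; first by exists 0; rewrite mulr0.
    by exists (v * (a : R) + w); rewrite mulrDr mulrA.
  have [|N maxN yN] := @maximal_above (subm yc).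
    by apply/negP => /(submP yc (1 : R)).
  have [] := maxN.1 => z; rewrite inE; apply/idP.
  have Ny : (y : right_regular R) \in N.
    by apply: yN; apply/(submP yc); exists 1; rewrite mulr1.
  have N1y : ((1 - y : R) : right_regular R) \in N.
    have : 1 - y \in @jacobson_pred R by apply/modJ_eqP; rewrite y1.
    by move=> /rad_predP; apply.
  have N1 : ((1 - y : R) : right_regular R) + y \in N by rewrite rpredD.
  have : (((1 - y : R) : right_regular R) + y) *> (z : R) \in N by apply: ract_sub.
  by rewrite right_regularE /= subrK mul1r.
move=> x1; have [v xv] := rinv x x1; exists v => //.
have [|w vw] := rinv v; first by rewrite -[LHS]mul1r -x1 -modJM xv.
by have -> : x = w; first rewrite -[x]mulr1 -vw mulrA xv mul1r.
Qed.

Lemma idem_modJ0 x : x * x = x -> modJ x = 0 -> x = 0.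
Proof.
move=> xx x0; have [|v vr _] := modJ1_unit (x := 1 - x).
  by rewrite modJB x0 subr0.
by rewrite -[x]mulr1 -vr mulrA mulrBr mulr1 xx subrr mul0r.
Qed.

Hypothesis sR : semiperfect_ring R.

(** Lift [y] to an idempotent [h0] of the ring.  Since [h0 * (1 - eps)] is in the
    radical, [w = 1 - h0 * (1 - eps)] is a unit, and it conjugates [h0] into
    [R eps]; multiplying by [eps] on the left then moves it into the corner. *)
Lemma lift_idem_below (eps : R) (y : B) : eps * eps = eps -> y * y = y ->
  modJ eps * y = y -> y * modJ eps = y ->
  exists h, [/\ h * h = h, eps * h = h, h * eps = h & modJ h = y].
Proof.
move=> ee yy ey ye; have [h0 h00 h0y] := sR.2 y yy.
have h0E : modJ h0 = y by [].
pose w := 1 - h0 * (1 - eps).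
have w1 : modJ w = 1.
  by rewrite modJB modJM modJB h0E !modJ1 mulrBr mulr1 ye subrr subr0.
have [v wv vw] := modJ1_unit w1.
have hw : h0 * w = h0 * eps.
  by rewrite /w mulrBr mulr1 mulrA h00 mulrBr mulr1 opprB addrC subrK.
pose h1 := v * h0 * w.
have h11 : h1 * h1 = h1.
  rewrite /h1 -!mulrA; congr (v * _); rewrite [w * (v * _)]mulrA wv mul1r.
  by rewrite mulrA h00.
have h1e : h1 * eps = h1.
  by rewrite /h1 -[v * h0 * w]mulrA hw -!mulrA ee.
have v1 : modJ v = 1 by rewrite -[LHS]mulr1 -w1 -modJM vw.
have h1y : modJ h1 = y by rewrite /h1 !modJM v1 w1 mul1r mulr1 h0E.
exists (eps * h1); clearbody h1; split.
- by rewrite mulrA -[eps * h1 * eps]mulrA h1e -mulrA h11.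
- by rewrite mulrA ee.
- by rewrite -mulrA h1e.
- by rewrite modJM h1y ey.
Qed.

Lemma primitive_modJ (eps : idempotent_of R) (y : B) : primitive_idem eps ->
  y * y = y -> modJ eps * y = y -> y * modJ eps = y -> y = 0 \/ y = modJ eps.
Proof.
move=> [_ pe] yy ey ye; have [h [hh eh he hy]] := lift_idem_below (idemP eps) yy ey ye.
pose f := Idempotent hh.
have gg : ((eps : R) - h) * ((eps : R) - h) = (eps : R) - h.
  by rewrite mulrBr !mulrBl idemP eh he hh subrr subr0.
have [|||h0|/subr0_eq eh0] := pe f (Idempotent gg).
- by rewrite /= mulrBr he hh subrr.
- by rewrite /= mulrBl eh hh subrr.
- by rewrite /= addrC subrK.
- by left; rewrite -hy [h]h0 modJ0.
- by right; rewrite eh0 hy.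
Qed.

(** The right ideal generated by [a] modulo the radical is a summand, hence
    generated by an idempotent below [eps], which is [eps] by primitivity. *)
Lemma primitive_generates (eps : idempotent_of R) a : primitive_idem eps ->
  (eps : R) * a = a -> modJ a <> 0 -> exists b, modJ (a * b) = modJ eps.
Proof.
move=> pe ea a0.
have Kc : submP_closed (fun z : right_regular B => exists c : B, modJ a * c = z).
  split=> [|r _ _ [c <-] [d <-]]; first by exists 0; rewrite mulr0.
  by exists (c * (r : B) + d); rewrite mulrDr mulrA.
have [K' [K0 Ksum]] := sR.1 (subm Kc).
have [_ [k [/submP[c <-] K'k one]]] := Ksum (1 : B).
have {}one : 1 = modJ a * c + (k : B) by [].
have kill (z : B) : (exists d, modJ a * d = z) -> (k : B) * z = 0 /\ modJ a * c * z = z.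
  move=> [d dz].
  have kz : (k : B) * z = z - modJ a * c * z.
    by apply/eqP; rewrite eq_sym subr_eq -mulrDl addrC -one mul1r.
  have kz0 : (k : B) * z = 0.
    apply: (K0 ((k : B) * z)); last exact: (ract_sub (z : B) K'k).
    apply/submP; exists (d - c * z); rewrite kz mulrBr dz mulrA //.
  by split=> //; apply/esym/subr0_eq; rewrite -kz.
have [_ aa] := kill (modJ a) (ex_intro _ 1 (mulr1 _)).
have [_ nn] := kill (modJ a * c) (ex_intro _ c erefl).
have eaJ : modJ eps * modJ a = modJ a by rewrite -modJM ea.
pose y := modJ a * c * modJ eps.
have en : modJ eps * (modJ a * c) = modJ a * c by rewrite mulrA eaJ.
have ey : modJ eps * y = y by rewrite /y mulrA en.
have eeJ : modJ eps * modJ eps = modJ eps by rewrite -modJM idemP.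
have ye : y * modJ eps = y by rewrite /y -mulrA eeJ.
have yy : y * y = y.
  by rewrite /y; move: (modJ a * c) en nn => z en nn; rewrite mulrA -(mulrA z) en nn.
have [y0|yE] := primitive_modJ pe yy ey ye.
  by case: a0; have <- : y * modJ a = modJ a; [rewrite /y -mulrA eaJ aa | rewrite y0 mul0r].
have [b bE] := modJ_surj (c * modJ eps).
by exists b; rewrite modJM bE mulrA.
Qed.

End ModuloRadical.

(** * Basic systems of idempotents *)

Section BasicSystem.
Variable R : pzRingType.

(** Orthogonal idempotents with sum [1], central modulo the radical, whose
    right ideals modulo the radical are simple: [R] modulo its radical is then a
    product of division rings.  The last three conditions depend on the classes
    of the idempotents only, hence are stable under conjugation by units that
    are congruent to 1. *)
Definition basic_system (n : nat) (eps : 'I_n -> R) :=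
  [/\ forall i, eps i * eps i = eps i,
      forall i j, i != j -> eps i * eps j = 0,
      \sum_i eps i = 1
    & [/\ forall i, modJ (eps i) <> 0,
          forall i x, modJ (x * eps i) = modJ (eps i * x)
        & forall i a, modJ (eps i * a) <> 0 ->
            exists b, modJ (eps i * a * b) = modJ (eps i)]].

Hypotheses (nR : right_noetherian R) (sR : semiperfect_ring R).

(** An element of [eta R eps] outside the radical is right invertible, because it
    generates [eta R] modulo the radical; primitivity of [eps] makes the right
    inverse two-sided. *)
Lemma primitive_iso (eps eta : idempotent_of R) x :
  primitive_idem eps -> primitive_idem eta ->
  modJ ((eta : R) * x * (eps : R)) <> 0 -> iso_mod (principal eps) (principal eta).
Proof.
move=> pe ph x0; set a := (eta : R) * x * (eps : R) in x0.
have ha : (eta : R) * a = a by rewrite /a !mulrA idemP.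
have ae : a * (eps : R) = a by rewrite /a -!mulrA idemP.
have [b bE] := primitive_generates nR sR ph ha x0.
clearbody a; pose t := (eta : R) - a * b * (eta : R).
have t0 : modJ t = 0.
  by rewrite modJB modJM bE -modJM idemP subrr.
have ht : (eta : R) * t = t by rewrite /t mulrBr idemP !mulrA ha.
have [|v tv _] := modJ1_unit nR (x := 1 - t); first by rewrite modJB t0 subr0.
pose b' := (eps : R) * b * (eta : R) * v * (eta : R).
have ab : a * b' = (eta : R).
  rewrite /b' !mulrA ae; have -> : a * b * (eta : R) = (eta : R) * (1 - t).
    by rewrite mulrBr mulr1 ht /t opprB addrC subrK.
  by rewrite -(mulrA _ (1 - t)) tv mulr1 idemP.
have eb : (eps : R) * b' = b' by rewrite /b' !mulrA idemP.
have bh : b' * (eta : R) = b' by rewrite /b' -!mulrA idemP.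
clearbody b'.
have hh : b' * a * (b' * a) = b' * a by rewrite mulrA -(mulrA b') ab bh.
have ehh : (eps : R) * (b' * a) = b' * a by rewrite mulrA eb.
have hhe : b' * a * (eps : R) = b' * a by rewrite -mulrA ae.
have gg : ((eps : R) - b' * a) * ((eps : R) - b' * a) = (eps : R) - b' * a.
  by rewrite mulrBr !mulrBl idemP ehh hhe hh subrr subr0.
have [|||h0|/subr0_eq ba] := pe.2 (Idempotent hh) (Idempotent gg).
- by rewrite /= mulrBr hhe hh subrr.
- by rewrite /= mulrBl ehh hh subrr.
- by rewrite /= addrC subrK.
- case/eqP: ph.1; rewrite -(idemP eta) -{1}ab -ab !mulrA -(mulrA a b' a).
  by rewrite [b' * a]h0 mulr0 mul0r.
have am : (a : right_regular R) \in principal_submod eta by apply/eqP.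
have bm : (b' : right_regular R) \in principal_submod eps by apply/eqP.
exists (principal_map eps (Submod am : principal eta)).
exists (principal_map eta (Submod bm : principal eps)) => x'.
- apply: val_inj; set y : R := val x'.
  have ey : (eps : R) * y = y by apply/eqP/(submod_valP x').
  transitivity (b' * (a * y)); first by [].
  by rewrite mulrA -ba ey.
- apply: val_inj; set y : R := val x'.
  have ey : (eta : R) * y = y by apply/eqP/(submod_valP x').
  transitivity (a * (b' * y)); first by [].
  by rewrite mulrA ab ey.
Qed.

(** The right ideals being non-isomorphic, [eps j * x * eps i] is in the radical
    for distinct [i] and [j]; this is centrality modulo the radical. *)
Lemma basic_system_exists : basic_ring R -> exists n (eps : 'I_n -> R), basic_system eps.
Proof.
move=> [n [eps [pe oe se ne]]]; exists n, (fun i => idem_val (eps i)).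
have off i j x : i != j -> modJ ((eps j : R) * x * (eps i : R)) = 0.
  by move=> ij; apply: contrapT => x0; apply: (ne i j ij); apply: primitive_iso x0.
have diag i x : modJ (x * (eps i : R)) = modJ ((eps i : R) * x * (eps i : R)).
  rewrite -{1}[x]mul1r -se !mulr_suml modJ_sum (bigD1 i) //= big1 ?addr0 //.
  by move=> j ji; apply: off; rewrite eq_sym.
have diag' i x : modJ ((eps i : R) * x) = modJ ((eps i : R) * x * (eps i : R)).
  rewrite -{1}[(eps i : R) * x]mulr1 -se !mulr_sumr modJ_sum (bigD1 i) //= big1 ?addr0 //.
  by move=> j ji; apply: off.
split=> //; first by move=> i; apply: idemP.
split.
- by move=> i /(idem_modJ0 nR (idemP (eps i))); apply/eqP/(pe i).1.
- by move=> i x; rewrite diag diag'.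
- by move=> i a; apply: primitive_generates => //; rewrite mulrA idemP.
Qed.

Lemma basic_system_conj n (eps : 'I_n -> R) u v : u * v = 1 -> v * u = 1 ->
  modJ u = 1 -> basic_system eps -> basic_system (fun i => u * eps i * v).
Proof.
move=> uv vu u1 [ie oe se [ne ce ge]].
have v1 : modJ v = 1 by rewrite -[LHS]mul1r -u1 -modJM uv.
have cE i : modJ (u * eps i * v) = modJ (eps i).
  by rewrite !modJM u1 v1 mul1r mulr1.
have conjM x y : u * x * v * (u * y * v) = u * (x * y) * v.
  by rewrite -!mulrA [v * (u * _)]mulrA vu mul1r.
split.
- by move=> i; rewrite conjM ie.
- by move=> i j ij; rewrite conjM oe // mulr0 mul0r.
- by rewrite -mulr_suml -mulr_sumr se mulr1.
split.
- by move=> i; rewrite cE.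
- by move=> i x; rewrite [LHS]modJM [RHS]modJM cE -!modJM.
- move=> i a; rewrite modJM cE -modJM => /ge[b bE]; exists b.
  by rewrite -mulrA modJM cE -modJM mulrA.
Qed.

(** Modulo the radical an idempotent is a sum of some of the [eps i]; it is then
    conjugate to this partial sum [g] by the unit [e g + (1 - e)(1 - g)]. *)
Lemma basic_system_adapted (e : idempotent_of R) : basic_ring R ->
  exists n (eps : 'I_n -> R) (I : {set 'I_n}),
    basic_system eps /\ \sum_(i in I) eps i = (e : R).
Proof.
move=> bR; have [n [eps beps]] := basic_system_exists bR.
have [ie oe se [ne ce ge]] := beps.
have dich i : modJ (eps i * (e : R)) = 0 \/ modJ (eps i * (e : R)) = modJ (eps i).
  have [|/ge[b bE]] := pselect (modJ (eps i * (e : R)) = 0); first by left.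
  right; transitivity (modJ ((e : R) * (eps i * (e : R) * b))).
    by rewrite -ce modJM -bE -modJM.
  rewrite !mulrA -(mulrA _ _ b) modJM ce -modJM.
  by rewrite !mulrA -(mulrA (eps i)) idemP bE.
pose I := [set i | `[< modJ (eps i * (e : R)) <> 0 >]].
pose g := \sum_(i in I) eps i.
have eg : modJ e = modJ g.
  rewrite -[idem_val e in LHS]mul1r -se mulr_suml !modJ_sum [RHS]big_mkcond /=.
  apply: eq_bigr => i _; rewrite inE; case: asboolP => [|/contrapT //].
  by case: (dich i) => ->.
have gg : g * g = g.
  rewrite /g mulr_suml; apply: eq_bigr => i iI; rewrite mulr_sumr (bigD1 i) //= ie.
  by rewrite big1 ?addr0 // => j /andP[_ ji]; apply: oe; rewrite eq_sym.
pose u := (e : R) * g + (1 - (e : R)) * (1 - g).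
have u1 : modJ u = 1.
  rewrite /u modJD !modJM !modJB -eg -!modJB -!modJM -modJD.
  by rewrite idemP [X in _ + X](idemP (idem_compl e)) addrC subrK.
have [v uv vu] := modJ1_unit nR u1.
have eu : (e : R) * u = u * g.
  have e1 : (e : R) * (1 - (e : R)) = 0 by rewrite mulrBr mulr1 idemP subrr.
  have g1 : (1 - g) * g = 0 by rewrite mulrBl mul1r gg subrr.
  rewrite /u (mulrDr (e : R)) (mulrDl _ _ g) !mulrA idemP e1 mul0r addr0.
  by rewrite -!mulrA gg g1 mulr0 addr0.
exists n, (fun i => u * eps i * v), I; split; first exact: basic_system_conj.
by rewrite -mulr_suml -mulr_sumr -/g -eu -mulrA uv mulr1.
Qed.

End BasicSystem.

(** * The radical of a module *)

Section MaximalSubmodules.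
Variable A : pzRingType.
Implicit Type M : lmodType A.

Lemma maximal_span M (N : submodClosed M) y z : maximal_submod N -> y \notin N ->
  exists a, z - a *: y \in N.
Proof.
move=> [_ maxN] yN.
have Kc : submP_closed (fun z => exists a, z - a *: y \in N).
  split=> [|c u v [a au] [b bv]]; first by exists 0; rewrite scale0r subr0 rpred0.
  exists (c * a + b); rewrite scalerDl -scalerA opprD addrACA -scalerBr.
  by rewrite rpredD // rpredZ.
have [u Nu|KN|KT] := maxN (subm Kc).
- by apply/submP; exists 0; rewrite scale0r subr0.
- case/negP: yN; rewrite -KN; apply/submP; exists 1.
  by rewrite scale1r subrr rpred0.
- by apply/(submP Kc); rewrite KT.
Qed.

Lemma maximal_intro M (N : submodClosed M) x : x \notin N ->
  (forall y z, y \notin N -> exists a, z - a *: y \in N) -> maximal_submod N.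
Proof.
move=> xN spanN; split=> [/(_ x)|K NK]; first by rewrite (negbTE xN) inE.
have [KN|/existsNP[y /not_implyP[Ky /negP yN]]] := pselect {subset K <= N}.
  by left=> y; apply/idP/idP; [exact: KN | exact: NK].
right=> z; rewrite inE; apply/idP; have [a az] := spanN y z yN.
by rewrite -(subrK (a *: y) z) rpredD ?rpredZ // NK.
Qed.

End MaximalSubmodules.

(** If [v *> r] avoids a maximal submodule [N], then the annihilator of [v]
    modulo [N] is a maximal right ideal that does not contain [r]. *)
Lemma jacobson_rad (R : pzRingType) (M : rmodType R) (v : M) r :
  modJ r = 0 -> v *> r \in Defs.rad M.
Proof.
move=> /modJ_eq0 Jr; apply/radP => N maxN; apply: contrapT => /negP vrN.
have Kc : submP_closed (fun a : right_regular R => v *> (a : R) \in N).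
  split=> [|a x y vx vy]; first by rewrite ract0 rpred0.
  by rewrite ractDr -ractM rpredD // ract_sub.
apply: (negP vrN); apply/(submP Kc); move/rad_predP: Jr; apply.
apply: (maximal_intro (x := (1 : R) : right_regular R)).
  apply: contra vrN => /(submP Kc); rewrite ract1; exact: ract_sub.
move=> y z yK; have [|a az] := @maximal_span _ M N (v *> (y : R)) (v *> (z : R)) maxN.
  by apply: contra yK => ?; apply/submP.
exists a; apply/submP; rewrite ractBr -ractM; exact: az.
Qed.

(** * The simple summands of the top *)

Section Top.
Variables (R : pzRingType) (e : idempotent_of R) (n : nat) (eps : 'I_n -> R).
Variable I : {set 'I_n}.
Hypotheses (beps : basic_system eps) (sumI : \sum_(i in I) eps i = (e : R)).

Local Notation T := (top_mod e).
Local Notation top := (quotmod_pi (Defs.rad (principal e))).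

Lemma topP (x : principal e) : top x = 0 <-> modJ (val x : R) = 0.
Proof.
rewrite quotmod_pi_eq0; split=> [xr|x0]; last first.
  by rewrite -(principal_gen x); apply: jacobson_rad.
apply/modJ_eq0/rad_predP => N maxN; apply: contrapT => /negP xN.
have : x \in preimage_sub (submod_incl (principal_submod e)) N.
  move/radP: xr; apply; apply: (maximal_intro (x := x)).
    by apply: contra xN => /preimage_subP.
  move=> y z yN; have [|a az] := @maximal_span _ _ N (val y) (val z) maxN.
    by apply: contra yN => ?; apply/preimage_subP.
  by exists a; apply/preimage_subP; rewrite submod_inclBZ.
by move=> /preimage_subP; apply/negP.
Qed.

Lemma top_modJ (z : T) a b : modJ a = modJ b -> z *> a = z *> b.
Proof.
move=> ab; apply/eqP; rewrite -subr_eq0 -ractBr; apply/eqP.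
have [x <-] := quotmod_pi_surj z; rewrite -ract_lin.
by apply/quotmod_pi_eq0/jacobson_rad; rewrite modJB ab subrr.
Qed.

(** Since the [eps l] are central modulo the radical, the simple summand for [l]
    is the set of elements of the top that [eps l] fixes. *)
Lemma isotypic_closed l : submP_closed (fun z : T => z *> eps l = z).
Proof.
have [_ _ _ [_ ce _]] := beps.
split=> [|a x y xl yl]; first by rewrite ract0l.
rewrite ractDl yl; congr (_ + _); rewrite -[a *: x]/(x *> a).
by rewrite ractM (top_modJ x (ce l _)) -ractM xl.
Qed.

Definition isotypic l : submodClosed T := subm (isotypic_closed l).

Lemma isotypicP l z : reflect (z *> eps l = z) (z \in isotypic l).
Proof. exact: submP. Qed.

Lemma isotypic_act l (z : T) : z *> eps l \in isotypic l.
Proof. by have [ie _ _ _] := beps; apply/isotypicP; rewrite ractM ie. Qed.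

Local Notation t1 := (top (principal_unit e)).

Lemma top_gen (z : T) : exists r, z = t1 *> r.
Proof.
have [x <-] := quotmod_pi_surj z; exists (val x : R).
by rewrite -ract_lin principal_gen.
Qed.

Lemma top_gen_eq0 r : t1 *> r = 0 <-> modJ ((e : R) * r) = 0.
Proof. by rewrite -ract_lin topP ract_val. Qed.

Lemma isotypic_span l (z w : T) : z \in isotypic l -> z <> 0 -> w \in isotypic l ->
  exists a, z *> a = w.
Proof.
have [ie _ _ [_ ce ge]] := beps.
move=> /isotypicP zl z0 /isotypicP wl.
have [x xz] := top_gen z; have [y yw] := top_gen w.
have zE : z = t1 *> (eps l * x) by rewrite -(top_modJ _ (ce l x)) -ractM -xz.
have wE : w = t1 *> (eps l * y) by rewrite -(top_modJ _ (ce l y)) -ractM -yw.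
have [|b bE] := ge l x.
  by move=> x0; apply: z0; rewrite zE -(ract0 t1); apply: top_modJ; rewrite x0 modJ0.
exists (b * y); rewrite zE wE ractM; apply: top_modJ.
by rewrite mulrA modJM bE -modJM.
Qed.

Lemma eps_sub l : l \in I -> (e : R) * eps l = eps l.
Proof.
have [ie oe _ _] := beps; move=> lI; rewrite -sumI mulr_suml (bigD1 l) //= ie.
by rewrite big1 ?addr0 // => i /andP[_ il]; apply: oe.
Qed.

Lemma eps_out l : l \notin I -> eps l * (e : R) = 0.
Proof.
have [_ oe _ _] := beps; move=> lI; rewrite -sumI mulr_sumr big1 // => i iI.
by apply: oe; apply: contraNneq lI => ->.
Qed.

Lemma top_eps_out l (z : T) : l \notin I -> z *> eps l = 0.
Proof.
have [_ _ _ [_ ce _]] := beps.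
move=> lI; have [r ->] := top_gen z; rewrite ractM; apply/top_gen_eq0.
by rewrite mulrA ce mulrA eps_out // mul0r modJ0.
Qed.

Lemma isotypic_nz l : l \in I -> t1 *> eps l <> 0.
Proof.
have [_ _ _ [ne _ _]] := beps.
by move=> lI /top_gen_eq0; rewrite eps_sub //; apply: ne.
Qed.

Lemma isotypic_off l l' z : l != l' -> z \in isotypic l -> z *> eps l' = 0.
Proof.
have [_ oe _ _] := beps.
by move=> ll' /isotypicP <-; rewrite ractM oe // ract0.
Qed.

Lemma isotypic_simple l : l \in I -> simple_mod (submod (isotypic l)).
Proof.
move=> lI; split.
  exists (Submod (isotypic_act l t1) : submod (isotypic l)).
  by apply/eqP => /(congr1 val); apply: isotypic_nz.
move=> N; have [[z [Nz z0]]|N0] := pselect (exists z, z \in N /\ z <> 0).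
  right=> w; rewrite inE; apply/idP.
  have [|a az] := isotypic_span (submod_mem z) _ (submod_mem w).
    by move=> vz; apply: z0; apply: val_inj.
  have -> : w = z *> a by apply: val_inj; rewrite ract_val.
  exact: ract_sub.
left=> z; rewrite inE; apply/idP/eqP => [Nz|->]; last exact: rpred0.
by apply: contrapT => z0; apply: N0; exists z.
Qed.

Lemma isotypic_decomposition m (sg : 'I_m -> 'I_n) : injective sg ->
  (forall l, l \in I <-> exists i, sg i = l) ->
  direct_decomposition (fun i => isotypic (sg i)).
Proof.
move=> sgi sgI; have [ie oe se _] := beps.
pose part (z : T) i : submod (isotypic (sg i)) := Submod (isotypic_act (sg i) z).
exists part => [w|z].
  apply: functional_extensionality_dep => j; apply: val_inj => /=.
  rewrite /ract scaler_sumr (bigD1 j) //= big1 ?addr0.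
    exact: (elimT (isotypicP (sg j) (val (w j))) (submod_mem (w j))).
  move=> i ij; apply: (isotypic_off (l := sg i)); last exact: submod_mem.
  by apply/eqP => /sgi ijE; rewrite ijE eqxx in ij.
rewrite -[RHS]ract1 -se /ract scaler_suml.
rewrite [RHS](bigID (mem I)) /= [X in _ + X]big1 ?addr0; last first.
  by move=> l; apply: top_eps_out.
have -> : I = [set sg i | i in [set: 'I_m]].
  apply/setP => l; apply/idP/imsetP => [/sgI[i <-]|[i _ ->]]; first by exists i.
  by apply/sgI; exists i.
rewrite big_imset /=; last by move=> i j _ _; apply: sgi.
by apply: eq_bigl => i; rewrite inE.
Qed.

End Top.

(** * Simple layers of torsion modules *)

Lemma gen_ideal_kills (R : pzRingType) (c : R) (V : rmodType R) (v : V) x :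
  (forall w : V, w *> c = 0) -> x \in gen_ideal_pred c -> v *> x = 0.
Proof.
move=> Vc /asboolP[u ->]; rewrite /ract scaler_suml big1 // => p _.
by rewrite -[LHS]/(v *> (p.1 * c * p.2)) -!ractM Vc ract0l.
Qed.

(** Chains of submodules of a cyclic module killed by the ideal pull back to
    chains of right ideals of the quotient ring. *)
Lemma artinian_minimal (R : pzRingType) (c : R) (V : rmodType R) (v : V) :
  right_artinian (quotring (gen_ideal c)) -> (forall w : V, w *> c = 0) -> v <> 0 ->
  exists2 K : submodClosed V, exists2 y, y \in K & y <> 0
    & forall K' : submodClosed V, {subset K' <= K} -> (exists2 y, y \in K' & y <> 0) ->
        {subset K <= K'}.
Proof.
move=> art Vc v0; apply: contrapT => nomin.
have vc : submP_closed (fun w : V => exists a, v *> a = w).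
  split=> [|r _ _ [a <-] [b <-]]; first by exists 0; rewrite ract0.
  by exists (a * (r : R) + b); rewrite ractDr -ractM.
pose X (K : submodClosed V) := (exists2 y, y \in K & y <> 0) /\ {subset K <= subm vc}.
have step (K : {K | X K}) :
    exists K' : {K | X K}, {subset sval K' <= sval K} /\ ~ {subset sval K <= sval K'}.
  case: K => K [K0 Kv] /=; apply: contrapT => nosmall; apply: nomin; exists K => // K' K'K K'0.
  apply: contrapT => KK'; apply: nosmall.
  have XK' : X K' by split=> // y /K'K/Kv.
  by exists (exist _ K' XK').
have [next nextP] := choice step.
have X0 : X (subm vc).
  by split=> //; exists v => //; apply/submP; exists 1; rewrite ract1.
pose ch i := sval (iter i next (exist _ (subm vc) X0)).
pose Q := quotring (gen_ideal c).
have piE (a b : R) : \pi_Q a = \pi_Q b -> v *> a = v *> b.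
  move/eqP; rewrite quotring_eqE => ab; apply/eqP; rewrite -subr_eq0 -ractBr.
  by apply/eqP; apply: gen_ideal_kills ab.
have Dc i : submP_closed (fun b : right_regular Q =>
    exists2 a : R, \pi_Q a = b & v *> a \in ch i).
  split=> [|r _ _ [a <- va] [b <- vb]].
    exists 0; last by rewrite ract0 rpred0.
    by apply: (addrI (\pi_Q 0)); rewrite -quotring_piD !addr0.
  pose r' : R := repr (r : Q); have rE : \pi_Q r' = r by rewrite reprK.
  exists (a * r' + b); last by rewrite ractDr -ractM rpredD // ract_sub.
  by rewrite quotring_piD quotring_piM rE.
have [|m mE] := art (fun i => subm (Dc i)).
  move=> i _ /submP[a <- va]; apply/submP; exists a => //.
  by have [sub _] := nextP (iter i next (exist _ (subm vc) X0)); apply: sub.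
have [_] := nextP (iter m next (exist _ (subm vc) X0)); apply => y ym.
have [_ /(_ y ym)/submP[a ay]] := proj2_sig (iter m next (exist _ (subm vc) X0)).
have : (\pi_Q a : right_regular Q) \in subm (Dc m.+1).
  by rewrite (mE _ (leqnSn m)); apply/submP; exists a; rewrite // ay.
by case/submP => b /piE ba; rewrite ba ay.
Qed.

Section Layers.
Variables (R : pzRingType) (e : idempotent_of R) (n : nat) (eps : 'I_n -> R).
Variables (I J : {set 'I_n}) (eJ : idempotent_of R).
Hypotheses (beps : basic_system eps) (sumI : \sum_(i in I) eps i = (e : R)).
Hypotheses (sumJ : \sum_(i in J) eps i = (eJ : R)) (JI : J \subset I).
Hypothesis nR : right_noetherian R.
Hypothesis art : right_artinian (quotring (gen_ideal (1 - (e : R)))).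

Local Notation T := (top_mod e).
Local Notation t1 := (quotmod_pi (Defs.rad (principal e)) (principal_unit e)).

(** A minimal nonzero submodule of a cyclic submodule of [H / W] contains some
    [Y = Y eps_l], which is killed by the radical.  It has the same annihilator as
    the generator [u] of the summand for [l], whence an isomorphism between the
    submodules that they generate. *)
Lemma isotypic_layers : has_simple_layers
  (idem_compl eJ) (fun l : {i | i \in J} => submod (isotypic e beps (val l))).
Proof.
have [ie oe se [ne ce ge]] := beps.
move=> H W tH [x xW]; pose V := quotmod W.
have tV := torsion_quotmod (W := W) tH.
have eJe : (1 - (e : R)) * (1 - (eJ : R)) = 1 - (e : R).
  have eeJ : (e : R) * (eJ : R) = (eJ : R).
    rewrite -sumJ mulr_sumr; apply: eq_bigr => i iJ.
    by apply: (eps_sub beps sumI); apply: (subsetP JI).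
  by rewrite mulrBr mulr1 mulrBl mul1r eeJ subrr subr0.
have Ve (w : V) : w *> (1 - (e : R)) = 0.
  by rewrite -eJe -ractM (tV (w *> (1 - (e : R)))).
have x0 : quotmod_pi W x <> 0 by move/quotmod_pi_eq0; apply/negP.
have [K [y Ky y0] Kmin] := artinian_minimal art Ve x0.
have [l yl0] : exists l, y *> eps l <> 0.
  apply: contrapT => nl; apply: y0; rewrite -[y]ract1 -se /ract scaler_suml big1 // => l _.
  by apply: contrapT => yl; apply: nl; exists l.
pose Y := y *> eps l.
have KY : Y \in K by apply: ract_sub.
have lJ : l \in J.
  apply: contraT => lJ; case: yl0.
  have -> : eps l = eps l * (1 - (eJ : R)).
    by rewrite mulrBr mulr1 (eps_out beps sumJ lJ) subr0.
  by rewrite -ractM (tV (y *> eps l)).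
have lI : l \in I by apply: (subsetP JI).
have Yl : Y *> eps l = Y by rewrite ractM ie.
have YJ r : modJ r = 0 -> Y *> r = 0.
  move=> r0; apply: contrapT => Yr0.
  have Kc : submP_closed (fun w : V => exists a, Y *> r *> a = w).
    split=> [|s _ _ [a <-] [b <-]]; first by exists 0; rewrite ract0.
    by exists (a * (s : R) + b); rewrite ractDr -ractM.
  have /(_ Y KY)/submP[a Ya] : {subset K <= subm Kc}.
    apply: Kmin; last by exists (Y *> r) => //; apply/submP; exists 1; rewrite ract1.
    by move=> _ /submP[a <-]; do 2!apply: ract_sub.
  have [|v rv _] := modJ1_unit nR (x := 1 - r * a).
    by rewrite modJB modJM r0 mul0r subr0.
  by apply: yl0; rewrite -/Y -[Y]ract1 -rv -ractM ractBr ract1 -ractM Ya subrr ract0l.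
have YmodJ a b : modJ a = modJ b -> Y *> a = Y *> b.
  by move=> ab; apply: subr0_eq; rewrite -ractBr; apply: YJ; rewrite modJB ab subrr.
pose u : T := t1 *> eps l.
have uI : u \in isotypic e beps l by apply: isotypic_act.
have ann r : Y *> r = 0 <-> u *> r = 0.
  rewrite (ractM t1) top_gen_eq0 mulrA (eps_sub beps sumI lI); split=> [Yr|r0]; last first.
    by rewrite -Yl ractM; apply: YJ.
  apply: contrapT => /ge[b bE]; apply: yl0; rewrite -/Y -Yl -(YmodJ _ _ bE).
  by rewrite -mulrA -2!ractM Yl Yr ract0l.
have W'c : submP_closed (fun x : H => exists a, quotmod_pi W x = Y *> a).
  split=> [|r z w [a az] [b bw]]; first by exists 0; rewrite linear0 ract0.
  by exists (a * (r : R) + b); rewrite linearP /= az bw ractDr -ractM.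
have uact a : u *> a \in isotypic e beps l by apply: ract_sub.
have [|||g gE] := @linear_graph _ (submod (subm W'c)) (submod (isotypic e beps l))
  (fun z w => exists2 a, quotmod_pi W (val z) = Y *> a & val w = u *> a).
- move=> z; have /submP[a az] := submod_mem z.
  by exists (Submod (uact a)), a.
- move=> r z w z' w' [a za wa] [b zb wb]; exists (a * (r : R) + b).
    by rewrite [val _](linearP (submod_incl _)) linearP ractDr -ractM; congr (_ *: _ + _).
  by rewrite [val _](linearP (submod_incl _)) ractDr -ractM; congr (_ *: _ + _).
- move=> w [a]; rewrite [val 0](linear0 (submod_incl _)) linear0 => /esym/ann ua wa.
  by apply: val_inj; rewrite wa ua.
exists (subm W'c), (exist _ l lJ), g; split.
- move=> z zW; apply/submP; exists 0; rewrite ract0.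
  by apply/quotmod_pi_eq0.
- move=> w; have [a ua] := isotypic_span uI (isotypic_nz beps sumI lI) (submod_mem w).
  have [z zY] := quotmod_pi_surj (Y *> a).
  have zW' : z \in subm W'c by apply/submP; exists a.
  by exists (Submod zW'); apply/gE; exists a; rewrite // ua.
- move=> z; rewrite -quotmod_pi_eq0; have [_ /(_ erefl)[a za wa]] := gE z (g z).
  rewrite za ann -wa; split=> [->|]; first exact: (linear0 (submod_incl _)).
  by move=> gz; apply: val_inj.
Qed.

End Layers.

(** * Sinks and orderings *)

Section Sinks.
Variables (n : nat) (edge : rel 'I_n).

Definition sink (J : {set 'I_n}) i := i \in J /\ forall j, j \in J -> ~~ edge i j.

Definition chordless_cycle (J : {set 'I_n}) (s : 'I_n -> 'I_n) :=
  [/\ forall i, i \in J -> s i \in J /\ edge i (s i),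
      forall j, j \in J -> exists2 i, i \in J & j = s i,
      {in J &, injective s}
    & forall i j, i \in J -> j \in J -> i != j -> ~~ edge i (s j)].

(** In a minimal sinkless set the image of any choice of arrows is sinkless
    again, hence everything: every choice of arrows is a permutation. *)
Lemma minimal_sinkless (J : {set 'I_n}) : (exists i, i \in J) ->
  (forall i, ~ sink J i) ->
  exists (J' : {set 'I_n}) s, [/\ J' \subset J, exists i, i \in J' & chordless_cycle J' s].
Proof.
have [k] := ubnP #|J|; elim: k J => // k IH J; rewrite ltnS => Jk J0 nosink.
have [[J' [J'J J'0 nosink']]|mini] := pselect (exists J' : {set 'I_n},
    [/\ J' \proper J, exists i, i \in J' & forall i, ~ sink J' i]).
  have [] := IH J' _ J'0 nosink'; first exact: leq_trans (proper_card J'J) Jk.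
  move=> J'' [s [J''J' J''0 cyc]]; exists J'', s; split=> //.
  exact: subset_trans J''J' (proper_sub J'J).
have out i : exists j, i \in J -> j \in J /\ edge i j.
  have [iJ|] := boolP (i \in J); last by exists i.
  apply: contrapT => nout; apply: (nosink i); split=> // j jJ; apply/negP => ij.
  by apply: nout; exists j.
have [s sP] := choice out.
have inj s' : (forall i, i \in J -> s' i \in J /\ edge i (s' i)) ->
    s' @: J = J /\ {in J &, injective s'}.
  move=> s'P; have sub : s' @: J \subset J.
    by apply/subsetP => _ /imsetP[i iJ ->]; have [] := s'P i iJ.
  have full : s' @: J = J.
    apply/eqP; apply: contraT => ne; case: mini; exists (s' @: J); split.
    - by rewrite properEneq ne.
    - by have [i iJ] := J0; exists (s' i); apply: imset_f.
    - move=> _ [/imsetP[i iJ ->] noedge].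
      have [siJ _] := s'P i iJ; have [_ ss] := s'P _ siJ.
      by have := noedge _ (imset_f s' siJ); rewrite ss.
  by split=> //; apply/imset_injP; rewrite full.
exists J, s; split=> //; split=> //.
- by move=> j; rewrite -{1}(inj s sP).1 => /imsetP[i iJ ->]; exists i.
- exact: (inj s sP).2.
- move=> i j iJ jJ ij; apply/negP => isj.
  (* Redirecting the arrow of [i] to [s j] yields a choice that is not injective. *)
  pose s' x := if x == i then s j else s x.
  have [|_ s'i] := inj s'.
    move=> x xJ; rewrite /s'; case: eqP => [->|_]; last exact: sP.
    by split=> //; have [] := sP j jJ.
  case/eqP: ij; apply: s'i => //.
  by rewrite /s' eqxx; case: eqP.
Qed.

(** A sink of [J] comes last, after an ordering of the rest. *)
Lemma sink_order (I J : {set 'I_n}) :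
  (forall J' : {set 'I_n}, J' \subset I -> (exists i, i \in J') -> exists i, sink J' i) ->
  J \subset I ->
  exists t : seq 'I_n, [/\ uniq t, t =i J & forall x i j, (j <= i)%N -> (i < size t)%N ->
    ~~ edge (nth x t i) (nth x t j)].
Proof.
move=> sinks; have [k] := ubnP #|J|; elim: k J => // k IH J; rewrite ltnS => Jk JI.
have [J0|nJ] := pselect (exists i, i \in J); last first.
  by exists [::]; split=> // i; apply/idP/idP => // iJ; case: nJ; exists i.
have [a [aJ noedge]] := sinks J JI J0.
have [||t [ut tJ to]] := IH (J :\ a).
- by apply: leq_trans Jk; rewrite [X in (_ < X)%N](cardsD1 a J) aJ.
- exact: subset_trans (subsetDl _ _) JI.
have tJ' x : x \in rcons t a = (x \in J).
  by rewrite mem_rcons inE tJ !inE; case: eqP => // ->.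
exists (rcons t a); split=> //.
  by rewrite rcons_uniq ut tJ !inE eqxx.
move=> x i j ji; rewrite size_rcons ltnS => it.
have jt : (j < size (rcons t a))%N by rewrite size_rcons ltnS (leq_trans ji).
move: it; case: (ltngtP i (size t)) => // it _; last first.
  rewrite nth_rcons it ltnn eqxx; apply: noedge.
  by rewrite -tJ'; apply: mem_nth.
by rewrite !nth_rcons it (leq_ltn_trans ji it); apply: to.
Qed.

End Sinks.

(** * Ordering the simple modules *)

Lemma regular_map_linear (R : pzRingType) (M : rmodType R) (m : M) :
  linear (fun x : right_regular R => m *> (x : R)).
Proof. by move=> a x y; rewrite ractDr -ractM. Qed.

Lemma right_regular_projective (R : pzRingType) : projective_mod (right_regular R).
Proof.
move=> M N f g fs; have [m mE] := fs (g (1 : R)).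
exists (linear_of (regular_map_linear m)) => x.
transitivity (f m *> (x : R)); first exact: ract_lin.
by rewrite mE -ract_lin; congr (g _); rewrite right_regularE mul1r.
Qed.

Lemma Ext_relative_one (R : pzRingType) (f : idempotent_of R) n (M N : rmodType R) k :
  (f : R) = 1 -> relative_resolution f n M -> (n < k)%N -> Ext_vanishes k M N.
Proof.
move=> f1 rM; elim: rM k => {n M} [M M0 k _|n M Q Z q i nM pQ _ ii qE qs _ IH [//|k] nk].
  exact: Ext_zero.
have siq : ses i q by split=> // y; apply: qs; rewrite f1 ract1.
by apply: (Ext_right siq); [exact: IH | exact: Ext_projective].
Qed.

Lemma relative_resolution_gldim (R : pzRingType) (e : idempotent_of R) :
  right_noetherian R -> finite_gldim (Gamma e) ->
  exists d, forall M : rmodType R, noetherian_mod M ->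
    relative_resolution (idem_compl e) d M.
Proof.
move=> nR [d gl]; exists d.+2 => M nM; apply: relative_resolution_exists => // N k dk.
exact: Ext_projdim (gl _) dk.
Qed.

Section Ordering.
Variables (R : pzRingType) (e : idempotent_of R) (n : nat) (eps : 'I_n -> R).
Variable I : {set 'I_n}.
Hypotheses (beps : basic_system eps) (sumI : \sum_(i in I) eps i = (e : R)).
Hypothesis nR : right_noetherian R.
Hypothesis art : right_artinian (quotring (gen_ideal (1 - (e : R)))).
Hypothesis gl : forall e' : idempotent_of R, sandwiched e e' -> finite_gldim (Gamma e').

Local Notation S l := (submod (isotypic e beps l)).

Definition Ext_edge (i j : 'I_n) : bool :=
  `[< exists2 k, (0 < k)%N & ~ Ext_vanishes k (S i) (S j) >].

Lemma Ext_edgeN i j k : ~~ Ext_edge i j -> (0 < k)%N -> Ext_vanishes k (S i) (S j).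
Proof.
move=> /asboolP noedge k0; apply: contrapT => Eij; apply: noedge; by exists k.
Qed.

Lemma noetherian_isotypic l : noetherian_mod (S l).
Proof. by do ![apply: noetherian_submod | apply: noetherian_quotmod]. Qed.

Lemma partial_sum_sandwiched (J : {set 'I_n}) : J \subset I ->
  exists2 eJ : idempotent_of R, \sum_(i in J) eps i = (eJ : R) & sandwiched e eJ.
Proof.
have [ie oe _ _] := beps; move=> JI; pose a := \sum_(i in J) eps i.
have aa : a * a = a.
  rewrite /a mulr_suml; apply: eq_bigr => i iI; rewrite mulr_sumr (bigD1 i) //= ie.
  by rewrite big1 ?addr0 // => j /andP[_ ji]; apply: oe; rewrite eq_sym.
have ea : (e : R) * a = a.
  rewrite /a mulr_sumr; apply: eq_bigr => i iJ.
  by apply: (eps_sub beps sumI); apply: (subsetP JI).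
have ae : a * (e : R) = a.
  rewrite /a -sumI mulr_suml; apply: eq_bigr => i iJ; rewrite mulr_sumr (bigD1 i) /=.
    by rewrite ie big1 ?addr0 // => j /andP[_ ji]; apply: oe; rewrite eq_sym.
  exact: (subsetP JI).
exists (Idempotent aa) => //= x /cornerP[y ->]; apply/eqP => /=.
have l1 : (1 - a) * (1 - (e : R)) = 1 - (e : R).
  by rewrite mulrBl mul1r mulrBr mulr1 ae subrr subr0.
have r1 : (1 - (e : R)) * (1 - a) = 1 - (e : R).
  by rewrite mulrBr mulr1 mulrBl mul1r ea subrr subr0.
by rewrite !mulrA l1 -!mulrA r1.
Qed.

Lemma Ext_isotypic_bounded : exists D, forall l m k, (D < k)%N -> Ext_vanishes k (S l) (S m).
Proof.
have [|e0 e0E se0] := @partial_sum_sandwiched set0; first exact: sub0set.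
have [D res] := relative_resolution_gldim nR (gl se0).
have one : (idem_compl e0 : R) = 1 by rewrite /= -e0E big_set0 subr0.
by exists D => l m k; apply: Ext_relative_one one (res _ (@noetherian_isotypic l)).
Qed.

(** The degree [p l] is the last one in which the arrow from [l] is visible; its
    existence rests on the finite global dimension of [R], its positivity on the
    definition of arrows. *)
Lemma Ext_sink (J : {set 'I_n}) : J \subset I -> (exists i, i \in J) ->
  exists i, sink Ext_edge J i.
Proof.
move=> JI J0; apply: contrapT => /forallNP /(minimal_sinkless J0).
case=> {J0} J' [s [J'J [i0 i0J] [sP ssurj sinj soff]]].
have {J'J}JI : J' \subset I := subset_trans J'J JI.
have [D bound] := Ext_isotypic_bounded.
have [eJ eJE seJ] := partial_sum_sandwiched JI.
have [d res] := relative_resolution_gldim nR (gl seJ).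
have [ie oe se _] := beps.
pose L := {i | i \in J'}.
have degP (l : L) : exists p, [/\ (0 < p <= D)%N,
    ~ Ext_vanishes p (S (val l)) (S (s (val l)))
  & forall k, (p < k)%N -> Ext_vanishes k (S (val l)) (S (s (val l)))].
  have [_ /asboolP[k k0 Ek]] := sP _ (valP l).
  pose Pk k := (0 < k)%N && `[< ~ Ext_vanishes k (S (val l)) (S (s (val l))) >].
  have exP : exists k, Pk k by exists k; rewrite /Pk k0; apply/asboolP.
  have boundP q : Pk q -> (q <= D)%N.
    by move=> /andP[_ /asboolP Eq]; rewrite leqNgt; apply/negP => /(bound _ _ _)/Eq.
  case: (ex_maxnP exP boundP) => q Pq maxq; exists q.
  have /andP[q0 /asboolP Eq] := Pq.
  split=> //; first by rewrite q0 boundP.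
  move=> j qj; apply: contrapT => Ej.
  have /maxq : Pk j by rewrite /Pk (leq_ltn_trans _ qj) //; apply/asboolP.
  by rewrite leqNgt qj.
have [p pP] := choice degP.
pose sL (l : L) : L := exist _ (s (val l)) (sP _ (valP l)).1.
have off (l l' : L) : val l != val l' -> ~~ Ext_edge (val l) (s (val l')).
  by apply: soff; apply: valP.
have u0 l : l \in I -> exists x : S l, x <> 0.
  move=> lI; exists (Submod (isotypic_act beps l (quotmod_pi _ (principal_unit e)))).
  by move=> /(congr1 val); apply: (isotypic_nz beps sumI lI).
have [x x0] := u0 i0 (subsetP JI _ i0J).
apply: x0; rewrite -[x]ract1.
pose L0 : L := exist _ i0 i0J.
have tors (l : L) : torsion (idem_compl eJ) (S (val l)).
  move=> z; apply: val_inj; rewrite ract_val.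
  have /isotypicP <- := submod_mem z.
  rewrite ractM mulrBr mulr1 -eJE mulr_sumr (bigD1 (val l)) ?(valP l) //= ie.
  by rewrite big1 ?addr0 ?subrr ?ract0 // => j /andP[_ jl]; apply: oe; rewrite eq_sym.
have := @relative_resolution_Hom R (idem_compl eJ) L (fun l => eps (val l))
  (fun l => S (val l)) sL p D _ _ _ _ (isotypic_layers beps sumI eJE JI nR art) _ _ _ _ _
  d (right_regular R) L0 tors (res _ nR) (@right_regular_projective R)
  (linear_of (regular_map_linear (x : S (val L0)))) (1 : R).
apply => {x}.
- by move=> l; apply: ie.
- by move=> l; apply/u0/(subsetP JI)/valP.
- by move=> l z; apply: val_inj; rewrite ract_val; apply/isotypicP/submod_mem.
- move=> l l' ll' z; apply: val_inj; rewrite ract_val.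
  apply: (isotypic_off (l := val l)); last exact: submod_mem.
  by apply/eqP => /val_inj.
- by move=> l; have [/andP[]] := pP l.
- by move=> l; have [/andP[]] := pP l.
- move=> l m k pk; have [jm jmJ ->] := ssurj _ (valP m).
  have [jl|jl] := eqVneq jm (val l).
    by rewrite jl; have [_ _] := pP l; apply.
  apply: Ext_edgeN; last exact: leq_ltn_trans pk.
  by apply: soff; rewrite ?(valP l) // eq_sym.
- move=> l l' k ll'; apply: Ext_edgeN; apply: off.
  by apply/eqP => /val_inj.
- by move=> l; have [] := pP l.
Qed.

End Ordering.

Theorem theorem3p9 (R : pzRingType) (e : idempotent_of R) :
  semiperfect_ring R ->
  noetherian_ring R ->
  basic_ring R ->
  right_artinian (quotring (gen_ideal (1 - (e : R)))) ->
  (forall e' : idempotent_of R, sandwiched e e' -> finite_gldim (Gamma e')) ->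
  exists (n : nat) (S : 'I_n -> submodClosed (top_mod e)),
    [/\ direct_decomposition S,
        forall i, simple_mod (submod (S i))
      & forall (i j : 'I_n) (k : nat), (j <= i)%N -> (0 < k)%N ->
          Ext_eq0 k (submod (S i)) (submod (S j))].
Proof.
move=> sR [_ nR] bR art gl.
have [n [eps [I [beps sumI]]]] := basic_system_adapted nR sR e bR.
have [t [ut tI to]] := sink_order (Ext_sink beps sumI nR art gl) (subxx I).
exists (size t), (fun i => isotypic e beps (tnth (in_tuple t) i)).
have tP i : tnth (in_tuple t) i \in I by rewrite -tI mem_tnth.
have noedge (i j : 'I_(size t)) : (j <= i)%N ->
    ~~ Ext_edge e beps (tnth (in_tuple t) i) (tnth (in_tuple t) j).
  move=> ji; pose x := tnth (in_tuple t) i.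
  have := to x i j ji (ltn_ord i).
  by rewrite -[nth x t i](tnth_nth x (in_tuple t) i) -[nth x t j](tnth_nth x (in_tuple t) j).
split.
- apply: (isotypic_decomposition beps sumI).
    exact: (elimT (tuple_uniqP (in_tuple t)) ut).
  move=> l; rewrite -tI; split=> [lt|[i <-]]; last exact: mem_tnth.
  by have /tnthP[i ->] : l \in in_tuple t by []; exists i.
- by move=> i; apply: (isotypic_simple beps sumI (tP i)).
- by move=> i j k ji k0; apply: Ext_vanishes_eq0 (Ext_edgeN (noedge i j ji) k0).
Qed.
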